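(* Let $\mathscr{C}$ be an additive category with a nonempty family of hermitian structures $\{( *_i,\omega_i)\}_{i\in I}$, and let $(M,\{s_i\})$, $(M',\{s'_i\})$, $(M'',\{s''_i\})$ be systems of sesquilinear forms over $(\mathscr{C},\{*_i,\omega_i\}_{i\in I})$. Assume that $\mathrm{End}_{\mathscr{C}}(M)$, $\mathrm{End}_{\mathscr{C}}(M')$ and $\mathrm{End}_{\mathscr{C}}(M'')$ are semiprimary rings in which $2$ is invertible. Then $$(M,\{s_i\})\oplus(M',\{s'_i\})\simeq(M,\{s_i\})\oplus(M'',\{s''_i\})\iff(M',\{s'_i\})\simeq(M'',\{s''_i\}),$$ where $\simeq$ denotes isometry and $\oplus$ orthogonal sum.
   Context: A ring $R$ is semiprimary if $R/\mathrm{Jac}(R)$ is semisimple and $\mathrm{Jac}(R)$ is nilpotent. A hermitian structure on an additive category $\mathscr{C}$ is a pair $( *,\omega)$ with $*:\mathscr{C}\to\mathscr{C}$ an (additive) contravariant functor and $\omega:\mathrm{id}\to **$ a natural transformation (not necessarily an isomorphism) with $\omega_C^*\,\omega_{C^*}=\mathrm{id}_{C^*}$ for all $C$. A system of sesquilinear forms over $(\mathscr{C},\{*_i,\omega_i\}_{i\in I})$ is a pair $(M,\{s_i\}_{i\in I})$ with $M\in\mathscr{C}$ and $s_i:M\to M^{*_i}$ any morphism for each $i$. An isometry $(M,\{s_i\})\to(M',\{s_i'\})$ is an isomorphism $f:M\to M'$ with $f^{*_i}s_i'f=s_i$ for all $i\in I$. The orthogonal sum is $(M\oplus M',\{s_i\oplus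 s'_i\})$. *)

(* Defs.v *)
From HB Require Import structures.
From mathcomp Require Import all_boot all_algebra ring_quotient.
From mathcomp Require Import boolp classical_sets.

Set Implicit Arguments.
Unset Strict Implicit.
Unset Printing Implicit Defensive.

Import GRing.Theory.
Local Open Scope ring_scope.
Local Open Scope quotient_scope.
Local Open Scope classical_set_scope.

(* All ring-theoretic notions are stated for [pzRingType]: the zero ring has to
   be allowed, since it is the endomorphism ring of a zero object. *)

Definition left_ideal (R : pzRingType) (I : set R) : Prop :=
  [/\ I 0, forall x y, I x -> I y -> I (x + y) & forall r x, I x -> I (r * x)].

Definition maximal_left_ideal (R : pzRingType) (I : set R) : Prop :=
  [/\ left_ideal I, ~ I 1 &
      forall K : set R, left_ideal K -> I `<=` K -> ~ K 1 -> K = I].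

Definition jac (R : pzRingType) : set R :=
  \bigcap_(m in @maximal_left_ideal R) m.
Arguments jac : clear implicits.

Section JacIdeal.
Variable R : pzRingType.
Implicit Types (I : set R) (x y r : R).

Lemma jac_left_ideal : left_ideal (jac R).
Proof.
split=> [m [[]]//|x y Jx Jy m mm|r x Jx m mm].
- by case: (mm) => -[_ mD _] _ _; apply: mD; [apply: Jx | apply: Jy].
- by case: (mm) => -[_ _ mM] _ _; apply: mM; apply: Jx.
Qed.

Lemma jac_mulr x r : jac R x -> jac R (x * r).
Proof.
move=> Jx m mm; have [[m0 mD mM] m1 mmax] := mm.
have [//|mxr] := pselect (m (x * r)).
pose n : set R := [set y | m (y * r)].
have nl : left_ideal n.
  split; rewrite /n /=; first by rewrite mul0r.
    by move=> a b; rewrite mulrDl; apply: mD.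
  by move=> s a; rewrite -mulrA; apply: mM.
suff nmax : maximal_left_ideal n by have := Jx n nmax.
have mr : ~ m r by move=> mr; apply: mxr; apply: mM.
split=> //; first by rewrite /n /= mul1r.
move=> K [K0 KD KM] nK K1; apply/seteqP; split=> // k Kk.
apply: contrapT => nk; apply: K1.
(* by maximality of m, the left ideal m + R k r is R *)
pose L : set R := [set z | exists a s, m a /\ z = a + s * (k * r)].
have Ll : left_ideal L.
  split; first by exists 0, 0; rewrite mul0r addr0.
    move=> _ _ [a [s [ma ->]]] [b [t [mb ->]]]; exists (a + b), (s + t).
    by split; [apply: mD | rewrite mulrDl addrACA].
  move=> t _ [a [s [ma ->]]]; exists (t * a), (t * s).
  by split; [apply: mM | rewrite mulrDr mulrA].
have mL : m `<=` L by move=> a ma; exists a, 0; rewrite mul0r addr0.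
have L1 : L 1.
  apply: contrapT => L1; apply: nk; rewrite /n /=.
  by rewrite -(mmax _ Ll mL L1); exists 0, 1; rewrite mul1r add0r.
have [a [s [ma e]]] := L1.
have nrsk : n (1 - r * s * k).
  rewrite /n /= mulrBl mul1r.
  have -> : r - r * s * k * r = r * a.
    by rewrite -{1}[r]mulr1 e mulrDr !mulrA addrK.
  exact: mM.
rewrite -(subrK (r * s * k) 1); apply: KD; first exact: nK.
exact: KM.
Qed.

Definition jac_pred : {pred R} := fun x => x \in jac R.

Lemma jac_zmod_closed : zmod_closed jac_pred.
Proof.
have [J0 JD JM] := jac_left_ideal.
split; first exact/mem_set.
move=> x y /set_mem Jx /set_mem Jy; apply/mem_set; apply: JD => //.
by rewrite -mulN1r; apply: JM.
Qed.

HB.instance Definition _ := GRing.isZmodClosed.Build R jac_pred jac_zmod_closed.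

(* The library makes {ideal_quot I} a zmodType for every additive subgroup I,
   but a ring only for proper ideals of commutative rings. *)
Definition jac_quot := {ideal_quot jac_pred}.

HB.instance Definition _ := GRing.Zmodule.on jac_quot.
HB.instance Definition _ :=
  EqQuotient.copy jac_quot {ideal_quot jac_pred}.

Definition jac_quot_one : jac_quot := lift_cst jac_quot 1.
Definition jac_quot_mul := lift_op2 jac_quot *%R.

Lemma pi_jac_eq x y : (\pi_jac_quot x = \pi_jac_quot y) <-> jac R (x - y).
Proof.
split=> [/eqP|Jxy]; first by rewrite -Quotient.idealrBE => /set_mem.
by apply/eqP; rewrite -Quotient.idealrBE; apply/mem_set.
Qed.

Lemma pi_jac_one : \pi_jac_quot 1 = jac_quot_one.
Proof. by rewrite /jac_quot_one; unlock. Qed.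

Lemma pi_jac_mul :
  {morph \pi_jac_quot : x y / x * y >-> jac_quot_mul x y}.
Proof.
have [J0 JD JM] := jac_left_ideal.
move=> x y; rewrite /jac_quot_mul; unlock; apply/pi_jac_eq.
set x' := repr _; set y' := repr _.
have Jx : jac R (x - x') by apply/pi_jac_eq; rewrite reprK.
have Jy : jac R (y - y') by apply/pi_jac_eq; rewrite reprK.
have -> : x * y - x' * y' = (x - x') * y + x' * (y - y').
  by rewrite mulrBl mulrBr addrA subrK.
by apply: JD; [apply: jac_mulr | apply: JM].
Qed.

Lemma jac_quot_ind (P : jac_quot -> Prop) :
  (forall x, P (\pi_jac_quot x)) -> forall q, P q.
Proof. by move=> H q; rewrite -[q]reprK. Qed.

Lemma pi_jac_add : {morph \pi_jac_quot : x y / x + y}.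
Proof. exact: (@raddfD _ _ (\pi_({ideal_quot jac_pred}))). Qed.

Lemma jac_quot_mulA : associative jac_quot_mul.
Proof.
move=> p q t; elim/jac_quot_ind: p => x; elim/jac_quot_ind: q => y.
by elim/jac_quot_ind: t => z; rewrite -!pi_jac_mul mulrA.
Qed.

Lemma jac_quot_mul1 : left_id jac_quot_one jac_quot_mul.
Proof. by elim/jac_quot_ind=> x; rewrite -pi_jac_one -pi_jac_mul mul1r. Qed.

Lemma jac_quot_mulr1 : right_id jac_quot_one jac_quot_mul.
Proof. by elim/jac_quot_ind=> x; rewrite -pi_jac_one -pi_jac_mul mulr1. Qed.

Lemma jac_quot_mulDl : left_distributive jac_quot_mul +%R.
Proof.
move=> p q t; elim/jac_quot_ind: p => x; elim/jac_quot_ind: q => y.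
by elim/jac_quot_ind: t => z; rewrite -pi_jac_add -!pi_jac_mul -pi_jac_add mulrDl.
Qed.

Lemma jac_quot_mulDr : right_distributive jac_quot_mul +%R.
Proof.
move=> p q t; elim/jac_quot_ind: p => x; elim/jac_quot_ind: q => y.
by elim/jac_quot_ind: t => z; rewrite -pi_jac_add -!pi_jac_mul -pi_jac_add mulrDr.
Qed.

HB.instance Definition _ := GRing.Zmodule_isPzRing.Build jac_quot
  jac_quot_mulA jac_quot_mul1 jac_quot_mulr1 jac_quot_mulDl jac_quot_mulDr.

End JacIdeal.

Arguments jac_quot : clear implicits.

(* The left regular module is semisimple: every submodule is a direct summand. *)
Definition semisimple_ring (R : pzRingType) : Prop :=
  forall I : set R, left_ideal I ->
  exists K : set R, [/\ left_ideal K,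
    I `&` K = [set 0] &
    forall x, exists a b, [/\ I a, K b & x = a + b]].

(* The n-th power of an ideal I is additively spanned by the products of n
   elements of I, so I ^ n = 0 means that these products vanish. *)
Definition nilpotent_ideal (R : pzRingType) (I : set R) : Prop :=
  exists n : nat, forall a : 'I_n -> R, (forall i, I (a i)) ->
  \prod_(i < n) a i = 0.

Definition semiprimary (R : pzRingType) : Prop :=
  semisimple_ring (jac_quot R) /\ nilpotent_ideal (jac R).

Definition invertible (R : pzRingType) (x : R) : Prop :=
  exists y : R, x * y = 1 /\ y * x = 1.

Reserved Notation "g \oc f" (at level 40, left associativity).

Record additive_category := AdditiveCategory {
  obj :> Type;
  Mor : obj -> obj -> zmodType;
  idm : forall A, Mor A A;
  compm : forall A B C, Mor B C -> Mor A B -> Mor A C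
    where "g \oc f" := (compm g f);
  compA : forall A B C D (h : Mor C D) (g : Mor B C) (f : Mor A B),
    h \oc (g \oc f) = (h \oc g) \oc f;
  comp1m : forall A B (f : Mor A B), idm B \oc f = f;
  compm1 : forall A B (f : Mor A B), f \oc idm A = f;
  compDl : forall A B C (g g' : Mor B C) (f : Mor A B),
    (g + g') \oc f = g \oc f + g' \oc f;
  compDr : forall A B C (g : Mor B C) (f f' : Mor A B),
    g \oc (f + f') = g \oc f + g \oc f';
  zero_obj : obj;
  zero_initial : forall A (f : Mor zero_obj A), f = 0;
  zero_terminal : forall A (f : Mor A zero_obj), f = 0;
  dsum : obj -> obj -> obj;
  in1 : forall A B, Mor A (dsum A B);
  in2 : forall A B, Mor B (dsum A B);
  pr1 : forall A B, Mor (dsum A B) A;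
  pr2 : forall A B, Mor (dsum A B) B;
  pr1_in1 : forall A B, pr1 A B \oc in1 A B = idm A;
  pr2_in2 : forall A B, pr2 A B \oc in2 A B = idm B;
  pr1_in2 : forall A B, pr1 A B \oc in2 A B = 0;
  pr2_in1 : forall A B, pr2 A B \oc in1 A B = 0;
  dsum_id : forall A B,
    in1 A B \oc pr1 A B + in2 A B \oc pr2 A B = idm (dsum A B)
}.

Arguments Mor {a} A B.
Arguments idm {a} A.
Arguments compm {a A B C} g f.
Arguments dsum {a} A B.
Arguments in1 {a} A B.
Arguments in2 {a} A B.
Arguments pr1 {a} A B.
Arguments pr2 {a} A B.
Notation "g \oc f" := (compm g f).

Definition End (C : additive_category) (M : C) : Type := Mor M M.

HB.instance Definition _ (C : additive_category) (M : C) :=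
  GRing.Zmodule.copy (End M) (Mor M M).

HB.instance Definition _ (C : additive_category) (M : C) :=
  GRing.Zmodule_isPzRing.Build (End M)
    (@compA C M M M M) (@comp1m C M M) (@compm1 C M M)
    (fun g g' f => @compDl C M M M g g' f)
    (fun g f f' => @compDr C M M M g f f').

Definition is_iso (C : additive_category) (A B : C) (f : Mor A B) : Prop :=
  exists g : Mor B A, g \oc f = idm A /\ f \oc g = idm B.

Record hermitian_structure (C : additive_category) := HermitianStructure {
  dual : C -> C;
  dualm : forall A B : C, Mor A B -> Mor (dual B) (dual A);
  dualm1 : forall A : C, dualm (idm A) = idm (dual A);
  dualm_comp : forall (A B D : C) (g : Mor B D) (f : Mor A B),
    dualm (g \oc f) = dualm f \oc dualm g;
  dualmD : forall (A B : C) (f g : Mor A B), dualm (f + g) = dualm f + dualm g;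
  omega : forall A : C, Mor A (dual (dual A));
  omega_natural : forall (A B : C) (f : Mor A B),
    omega B \oc f = dualm (dualm f) \oc omega A;
  omega_dual : forall A : C, dualm (omega A) \oc omega (dual A) = idm (dual A)
}.

Arguments dual {C} h A.
Arguments dualm {C} h {A B} f.

Record sesq_system (C : additive_category) (I : Type)
    (h : I -> hermitian_structure C) := SesqSystem {
  carrier : C;
  form : forall i : I, Mor carrier (dual (h i) carrier)
}.

Arguments form {C I h} s i.

Definition isometric (C : additive_category) (I : Type)
    (h : I -> hermitian_structure C) (S S' : sesq_system h) : Prop :=
  exists f : Mor (carrier S) (carrier S'),
    is_iso f /\ forall i, dualm (h i) f \oc form S' i \oc f = form S i.

(* Under the identification of the dual of a direct sum with the direct sum of
   the duals, the form below is the direct sum of the two forms. *)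
Definition orth_sum (C : additive_category) (I : Type)
    (h : I -> hermitian_structure C) (S S' : sesq_system h) : sesq_system h :=
  let M := carrier S in
  let M' := carrier S' in
  @SesqSystem C I h (dsum M M') (fun i =>
    dualm (h i) (pr1 M M') \oc form S i \oc pr1 M M' +
    dualm (h i) (pr2 M M') \oc form S' i \oc pr2 M M').

(* Main.v *)
(* Systems of forms over C are the objects of a category with involution whose
   morphisms are pairs of mutually adjoint maps, and whose unitary morphisms are
   the isometries; the natural transformations omega play no role.  From
   S + S' ~ S + S'' one gets H + S' ~ H + S'' with H = -S + S, and since 2 is
   invertible H is hyperbolic: id_H = e + e^† with e an idempotent orthogonal to
   its adjoint.  In the ring with involution E of endomorphisms of H + S'', Witt
   cancellation of H amounts to extending each partial isometry defined on
   e + e^† to a unitary.  The extension property is additive in e, and for e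
   local it follows from Eichler transformations.  Finally e is a finite sum of
   local idempotents: the maps of a pair in e E e lie in corners isomorphic to
   the semiprimary ring End M, where each element has a power with a group
   inverse and orthogonal families of idempotents are finite.  Group inverses
   being canonical, those of two adjoint maps are adjoint. *)

From HB Require Import structures.
From mathcomp Require Import all_boot all_algebra.
From mathcomp Require Import boolp classical_sets.
Require Import Defs.

Set Implicit Arguments.
Unset Strict Implicit.
Unset Printing Implicit Defensive.

Import GRing.Theory.
Local Open Scope ring_scope.

(** * Group inverses and descending chains of powers *)

Definition group_inverse (R : pzRingType) (b g : R) :=
  [/\ b * g = g * b, b * g * b = b & g * b * g = g].

Lemma power_right_add (R : pzRingType) (a : R) n m :
    (exists y, a ^+ n = a ^+ n.+1 * y) ->
  exists y, a ^+ n = a ^+ (n + m) * y.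
Proof.
move=> [y0 yE]; elim: m => [|m [y IH]]; first by exists 1; rewrite addn0 mulr1.
by exists (y0 * y); rewrite {1}IH addnC exprD yE !mulrA -exprD addnS addnC addnS.
Qed.

Lemma power_left_add (R : pzRingType) (a : R) n m :
    (exists y, a ^+ n = y * a ^+ n.+1) ->
  exists y, a ^+ n = y * a ^+ (n + m).
Proof.
move=> [y0 yE]; elim: m => [|m [y IH]]; first by exists 1; rewrite addn0 mul1r.
by exists (y * y0); rewrite {1}IH exprD yE -!mulrA -exprD addnS.
Qed.

(** * Semisimple rings: chain condition, regularity, stable powers *)

Section SemisimpleRing.
Variable R : pzRingType.
Hypothesis ssR : semisimple_ring R.

(** Write 1 = a + b along the union [V] and a complement [K]. Then a lies in some [U N], and x = x a
    for each x in [V], since x b lies in both [V] and [K]. *)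
Lemma semisimple_acc (U : nat -> set R) :
    (forall n, left_ideal (U n)) -> (forall n x, U n x -> U n.+1 x) ->
  exists N, forall n x, U n x -> U N x.
Proof.
move=> Ul Uincr.
have Ule m n x : (m <= n)%N -> U m x -> U n x.
  by move=> /subnK <-; elim: (n - m)%N => //= d IH Umx; apply/Uincr/IH.
pose V : set R := fun x => exists n, U n x.
have Vl : left_ideal V.
  split=> [|x y [m Umx] [n Uny]|r x [n Unx]].
  - by exists 0; case: (Ul 0).
  - exists (maxn m n); case: (Ul (maxn m n)) => _ + _; apply.
      exact: Ule (leq_maxl m n) Umx.
    exact: Ule (leq_maxr m n) Uny.
  - by exists n; case: (Ul n) => _ _; apply.
have [V0 VD VM] := Vl.
have [K [[K0 KD KM] VK /(_ 1) [a [b [[N UNa] Kb e1]]]]] := ssR Vl.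
exists N => n x Unx.
have Vx : V x by exists n.
have xE : x = x * a + x * b by rewrite -mulrDr -e1 mulr1.
have xb0 : x * b = 0.
  suff : (V `&` K)%classic (x * b) by rewrite VK.
  split; last exact: KM.
  have -> : x * b = x + (- x) * a by rewrite mulNr {2}xE [x * a + _]addrC addrK.
  by apply: VD => //; exists N; case: (Ul N) => _ _; apply.
by rewrite xE xb0 addr0; case: (Ul N) => _ _; apply.
Qed.

Lemma left_annihilator_ideal (P : R -> Prop) :
  left_ideal (fun x => forall y, P y -> x * y = 0).
Proof.
split=> [y _|x x' xP xP' y Py|r x xP y Py]; first by rewrite mul0r.
  by rewrite mulrDl xP // xP' // addr0.
by rewrite -mulrA xP // mulr0.
Qed.

(** The left annihilators of the tails of [d] form an increasing chain. Once it is stationary,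
    [d n], which kills the later terms, also kills itself. *)
Lemma semisimple_orth_idem (d : nat -> R) :
    (forall n, d n * d n = d n) ->
    (forall m n, (m < n)%N -> d m * d n = 0) ->
  exists N, forall n, (N <= n)%N -> d n = 0.
Proof.
move=> dd d0.
pose P n y := exists2 m, (n <= m)%N & y = d m.
have [||N UN] := @semisimple_acc (fun n x => forall y, P n y -> x * y = 0).
- by move=> n; apply: left_annihilator_ideal.
- by move=> n x xP y [m /ltnW nm ->]; apply: xP; exists m.
exists N => n Nn; rewrite -dd; apply: (UN n.+1); last by exists n.
by move=> _ [m nm ->]; apply: d0.
Qed.

(** Decompose 1 = c b + k along R b and a complement: b k = b - b c b lies in both summands. *)
Lemma semisimple_regular (b : R) : exists c, b = b * c * b.
Proof.
pose I : set R := fun x => exists c, x = c * b.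
have Il : left_ideal I.
  split=> [|_ _ [c ->] [c' ->]|r _ [c ->]]; first by exists 0; rewrite mul0r.
    by exists (c + c'); rewrite mulrDl.
  by exists (r * c); rewrite mulrA.
have [K [[_ _ KM] IK /(_ 1) [_ [k [[c ->] Kk e1]]]]] := ssR Il.
exists c.
have bE : b = b * c * b + b * k by rewrite -mulrA -mulrDr -e1 mulr1.
have bk0 : b * k = 0.
  suff : (I `&` K)%classic (b * k) by rewrite IK.
  split; last exact: KM.
  by exists (1 - b * c); rewrite mulrBl mul1r {2}bE [_ * b + _]addrC addrK.
by rewrite {1}bE bk0 addr0.
Qed.

(** The left annihilators of the powers of [a] become stationary. By regularity some 1 - a^(n+1) c
    kills a^(n+1), hence also a^n. *)
Lemma semisimple_power_right (a : R) : exists n y, a ^+ n = a ^+ n.+1 * y.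
Proof.
have [||n annI] := @semisimple_acc (fun n x => forall y, y = a ^+ n -> x * y = 0).
- by move=> n; apply: left_annihilator_ideal.
- by move=> n x xP _ ->; rewrite exprSr mulrA xP // mul0r.
have [c cE] := semisimple_regular (a ^+ n.+1).
exists n, (c * a ^+ n); apply/eqP; rewrite -subr_eq0 mulrA -{1}[_ ^+ n]mul1r.
rewrite -mulrBl; apply/eqP/(annI n.+1) => // _ ->.
by rewrite mulrBl mul1r -cE subrr.
Qed.

(* Otherwise the matrix units built from w and x would give infinitely many
   orthogonal idempotents. *)
Lemma semisimple_dedekind_finite (e x w : R) :
    e * x = x -> x * e = x -> e * w = w -> w * e = w -> e * e = e ->
  x * w = e -> w * x = e.
Proof.
move=> ex xe ew we ee xw.
pose d n := w ^+ n * (e - w * x) * x ^+ n.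
have xz : x * (e - w * x) = 0 by rewrite mulrBr xe mulrA xw ex subrr.
have zw : (e - w * x) * w = 0 by rewrite mulrBl ew -mulrA xw we subrr.
have ez : e * (e - w * x) = e - w * x by rewrite mulrBr ee mulrA ew.
have ze : (e - w * x) * e = e - w * x by rewrite mulrBl ee -mulrA xe.
have ewy n y : e * y = y -> e * (w ^+ n * y) = w ^+ n * y.
  by case: n => [|n] ey; rewrite ?mul1r // exprS -mulrA mulrA ew.
have xwy n y : e * y = y -> x ^+ n * (w ^+ n * y) = y.
  elim: n => [|n IH] ey; first by rewrite !mul1r.
  by rewrite exprSr exprS -!mulrA (mulrA x) xw ewy ?IH.
have zz : (e - w * x) * (e - w * x) = e - w * x.
  by rewrite {1}mulrBl ez -mulrA xz mulr0 subr0.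
have [|m n mn|N dN] := @semisimple_orth_idem d.
- move=> n; rewrite /d -!mulrA xwy; last by rewrite mulrA ez.
  by rewrite (mulrA (e - _)) zz.
- rewrite /d -(subnKC mn) addSnnS exprD -!mulrA xwy.
    by rewrite exprS (mulrA _ (w * _)) (mulrA _ w) zw !mul0r mulr0.
  by rewrite ewy // mulrA ez.
(* Multiplying the vanishing idempotent [d N] by powers of [x] and [w] recovers the defect e - w
   x. *)
have : e - w * x = x ^+ N * (d N * (w ^+ N * e)).
  by rewrite /d -!mulrA !xwy ?ze.
by rewrite dN // mul0r mulr0 => /eqP; rewrite subr_eq0 => /eqP.
Qed.

(** Some power [b] of [a] lies in b^2 R. The idempotent [e] generates the right ideal b R, so
    [b * e] has a right inverse in e R e. Dedekind finiteness makes it two-sided, which puts [b] in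
    R b^2. *)
Lemma semisimple_power_left (a : R) : exists n y, a ^+ n = y * a ^+ n.+1.
Proof.
have [n /(power_right_add n.+2) [y yE]] := semisimple_power_right a.
set b := a ^+ n.+1.
have bE : b = b * (b * (y * a)).
  by rewrite /b [LHS]exprSr {1}yE !mulrA -!exprD addSnnS.
have [c bcb] := semisimple_regular b; rewrite -mulrA in bcb.
have bcbA t : b * (c * (b * t)) = b * t by rewrite [in RHS]bcb !mulrA.
have bbyaA t : b * (b * (y * (a * t))) = b * t by rewrite [in RHS]bE !mulrA.
pose e := b * c.
have eb : e * b = b by rewrite -mulrA.
have wx : b * (y * a) * (c * e) * (b * e) = e.
  by apply: (semisimple_dedekind_finite (e := e));
    rewrite // /e -!mulrA ?(bcbA, bbyaA).
exists n.+1, (b * (y * a) * (c * e) * a ^+ n).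
have -> : b * (y * a) * (c * e) * a ^+ n * a ^+ n.+2 = b * (y * a) * (c * e) * b * b.
  by rewrite -mulrA -exprD addnS -addSn exprD !mulrA.
rewrite -[RHS]mulrA; have -> : b * b = b * e * b by rewrite -mulrA eb.
by rewrite mulrA wx eb.
Qed.
End SemisimpleRing.

(** * Semiprimary rings: lifting along the nilpotent radical *)

Section Semiprimary.
Variable R : pzRingType.
Hypothesis spR : semiprimary R.

Definition jac_product k (x : R) :=
  exists2 a : 'I_k -> R, (forall i, jac R (a i)) & x = \prod_(i < k) a i.

Lemma jac_product1 x : jac R x -> jac_product 1 x.
Proof. by move=> Jx; exists (fun=> x) => //; rewrite big_ord1. Qed.

Lemma jac_productMl k y x :
  jac R y -> jac_product k x -> jac_product k.+1 (y * x).
Proof.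
move=> Jy [a Ja ->]; exists (fun i => oapp a y (unlift ord0 i)).
  by move=> i; case: unliftP => /=.
rewrite big_ord_recl unlift_none /=; congr (_ * _).
by apply: eq_bigr => i _; rewrite liftK.
Qed.

Lemma jac_productMr k y x :
  jac R y -> jac_product k x -> jac_product k.+1 (x * y).
Proof.
move=> Jy [a Ja ->]; exists (fun i => oapp a y (unlift ord_max i)).
  by move=> i; case: unliftP => /=.
rewrite big_ord_recr unlift_none /=; congr (_ * _).
apply: eq_bigr => i _; have -> : widen_ord (leqnSn k) i = lift ord_max i.
  by apply: val_inj; rewrite /= /bump leqNgt ltn_ord.
by rewrite liftK.
Qed.

(** The exponent is made positive because the products built below start from a single factor. *)
Lemma jac_product_nil : exists n, forall x, jac_product n.+1 x -> x = 0.
Proof.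
have [_ [n nilJ]] := spR; exists n => x [a Ja ->].
by rewrite big_ord_recl (nilJ (fun i => a (lift ord0 i))) ?mulr0.
Qed.

Lemma pi_jacM (x y : R) :
  (\pi_(jac_quot R) (x * y) = \pi_(jac_quot R) x * \pi_(jac_quot R) y)%qT.
Proof. exact: pi_jac_mul. Qed.

Lemma pi_jacX (x : R) n :
  (\pi_(jac_quot R) (x ^+ n) = \pi_(jac_quot R) x ^+ n)%qT.
Proof.
elim: n => [|n IH]; first by rewrite !expr0 pi_jac_one.
by rewrite !exprS pi_jacM IH.
Qed.

(** Modulo the radical the powers of [a] stabilise. Errors of the form a^N - a^(N+1) z multiply to
    errors of the same form, and a long enough product of them vanishes by nilpotency. *)
Lemma semiprimary_power_right (a : R) : exists n y, a ^+ n = a ^+ n.+1 * y.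
Proof.
have [ss _] := spR.
have [n ynP] := semisimple_power_right ss (\pi_(jac_quot R) a)%qT.
have yP m : exists y, jac R (a ^+ n - a ^+ (n + m) * y).
  have [y yE] := power_right_add m ynP; exists (repr y).
  by apply/pi_jac_eq; rewrite pi_jacM !pi_jacX reprK.
have prodP k : exists N z, jac_product k.+1 (a ^+ N - a ^+ N.+1 * z).
  elim: k => [|k [N [z pz]]].
    by have [y Jy] := yP 1%N; exists n, y; apply: jac_product1; rewrite -addn1.
  (* With this exponent, every term of the product other than a^(n+N) is a right multiple of
     a^(n+N+1). *)
  have [y Jy] := yP N.+1.
  exists (n + N)%N, (z + y * (a ^+ N - a ^+ N.+1 * z)).
  suff -> : a ^+ (n + N) - a ^+ (n + N).+1 * (z + y * (a ^+ N - a ^+ N.+1 * z))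
     = (a ^+ n - a ^+ (n + N.+1) * y) * (a ^+ N - a ^+ N.+1 * z).
    exact: jac_productMl.
  by rewrite addnS mulrDr opprD addrA mulrA mulrBl -addnS exprD
    (exprD _ n N.+1) -(mulrA _ _ z) -mulrBr.
have [k /(_ _) J0] := jac_product_nil; have [N [z /J0 /eqP]] := prodP k.
by rewrite subr_eq0 => /eqP; exists N, z.
Qed.

(** The mirror argument, with each new error multiplied on the right. *)
Lemma semiprimary_power_left (a : R) : exists n y, a ^+ n = y * a ^+ n.+1.
Proof.
have [ss _] := spR.
have [n ynP] := semisimple_power_left ss (\pi_(jac_quot R) a)%qT.
have yP m : exists y, jac R (a ^+ n - y * a ^+ (n + m)).
  have [y yE] := power_left_add m ynP; exists (repr y).
  by apply/pi_jac_eq; rewrite pi_jacM !pi_jacX reprK.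
have prodP k : exists N z, jac_product k.+1 (a ^+ N - z * a ^+ N.+1).
  elim: k => [|k [N [z pz]]].
    by have [y Jy] := yP 1%N; exists n, y; apply: jac_product1; rewrite -addn1.
  have [y Jy] := yP N.+1.
  exists (n + N)%N, (z + (a ^+ N - z * a ^+ N.+1) * y).
  suff -> : a ^+ (n + N) - (z + (a ^+ N - z * a ^+ N.+1) * y) * a ^+ (n + N).+1
     = (a ^+ N - z * a ^+ N.+1) * (a ^+ n - y * a ^+ (n + N.+1)).
    exact: jac_productMr.
  by rewrite mulrDl opprD addrA mulrBr -addnS -!mulrA; congr (_ - _);
    rewrite mulrBl -mulrA -!exprD addSn addnS addnC.
have [k /(_ _) J0] := jac_product_nil; have [N [z /J0 /eqP]] := prodP k.
by rewrite subr_eq0 => /eqP; exists N, z.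
Qed.

(** The images in the semisimple quotient vanish eventually, and an idempotent in the nilpotent
    radical is zero. *)
Lemma semiprimary_orth_idem (d : nat -> R) :
    (forall n, d n * d n = d n) ->
    (forall m n, (m < n)%N -> d m * d n = 0) ->
  exists N, forall n, (N <= n)%N -> d n = 0.
Proof.
move=> dd d0; have [ss _] := spR.
have pi0 : (\pi_(jac_quot R) 0 = 0)%qT.
  by apply: (addrI (\pi_(jac_quot R) 0)%qT); rewrite -pi_jac_add !addr0.
have [|m n mn|N dN] := @semisimple_orth_idem _ ss (fun n => \pi_(jac_quot R) (d n))%qT.
- by move=> n; rewrite -pi_jacM dd.
- by rewrite -pi_jacM d0.
have [k J0] := jac_product_nil; exists N => n Nn.
have Jd : jac R (d n) by rewrite -[d n]subr0; apply/pi_jac_eq; rewrite dN.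
apply: J0; exists (fun=> d n) => //.
by elim: k => [|k IH]; rewrite big_ord_recl ?big_ord0 ?mulr1 // -IH dd.
Qed.

(* b = b^2 y = z b^2 gives b the group inverse z b y. *)
Lemma semiprimary_group_inverse (a : R) : exists n g, group_inverse (a ^+ n.+1) g.
Proof.
have [n [y0 y0E]] := semiprimary_power_right a.
have [m [z0 z0E]] := semiprimary_power_left a.
have [y yE] : exists y, a ^+ (m + n).+1 = a ^+ ((m + n).+1 + (m + n).+1) * y.
  apply: power_right_add; exists y0.
  by rewrite -addSn exprD y0E !mulrA -exprD addnS.
have [z zE] : exists z, a ^+ (m + n).+1 = z * a ^+ ((m + n).+1 + (m + n).+1).
  apply: power_left_add; exists z0.
  by rewrite -addnS exprD z0E -!mulrA -exprD addSn.
rewrite exprD in yE zE; exists (m + n)%N, (z * a ^+ (m + n).+1 * y).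
move: (a ^+ (m + n).+1) yE zE => b yE zE.
have zb : z * b = b * y by rewrite {1}yE !mulrA -(mulrA z) -zE.
have byb : b * y * b = b by rewrite -zb -mulrA -zE.
have bzb : b * z * b = b by rewrite -mulrA zb mulrA -yE.
have zbyb : z * b * y * b = z * b by rewrite -2!mulrA (mulrA b) byb.
split; rewrite !mulrA ?zbyb.
- by rewrite bzb zb.
- by rewrite bzb byb.
- by rewrite -(mulrA z b z) -(mulrA z _ b) bzb.
Qed.
End Semiprimary.

(** * Unitaries, partial isometries and Eichler transformations in a ring with involution *)

Section Witt.
Variables (E : pzRingType) (dag : E -> E).
Implicit Types (e f g k u v w x y : E).
Local Notation "x ^†" := (dag x) (at level 1, format "x ^†").
Hypothesis dagD : forall x y, (x + y)^† = x^† + y^†.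
Hypothesis dagM : forall x y, (x * y)^† = y^† * x^†.
Hypothesis dagK : forall x, x^†^† = x.

Lemma dag0 : 0^† = 0.
Proof. by apply: (addrI 0^†); rewrite -dagD !addr0. Qed.

Lemma dagN x : (- x)^† = - x^†.
Proof. by apply: (addrI x^†); rewrite -dagD !subrr dag0. Qed.

Lemma mul_orth (x y a b : E) : x * a = x -> b * y = y -> a * b = 0 -> x * y = 0.
Proof. by move=> <- <- ab; rewrite mulrA -(mulrA x) ab mulr0 mul0r. Qed.

(** Unitaries of the corner g E g. The projection [g] varies because the additivity argument works
    in smaller corners and glues the results. *)
Definition unitary_on g u :=
  [/\ g * u = u, u * g = u, u^† * u = g & u * u^† = g].

Lemma unitary_on_dag g u : g^† = g -> unitary_on g u -> unitary_on g u^†.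
Proof. by move=> gE [gu ug u1 u2]; split; rewrite ?dagK // -{1}gE -dagM ?ug ?gu. Qed.

Lemma unitary_onM g u w : unitary_on g u -> unitary_on g w -> unitary_on g (u * w).
Proof.
move=> [gu ug u1 u2] [gw wg w1 w2]; split.
- by rewrite mulrA gu.
- by rewrite -mulrA wg.
- by rewrite dagM -mulrA (mulrA u^†) u1 gw.
- by rewrite dagM -mulrA (mulrA w) w2 mulrA ug.
Qed.

Lemma unitary_onD f g u : f * f = f -> f^† = f -> f * g = 0 -> g * f = 0 ->
  unitary_on g u -> unitary_on (f + g) (f + u).
Proof.
move=> ff fE fg gf [gu ug u1 u2].
have fu : f * u = 0 by rewrite -gu mulrA fg mul0r.
have uf : u * f = 0 by rewrite -ug -mulrA gf mulr0.
have fu' : f * u^† = 0 by rewrite -{1}fE -dagM uf dag0.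
have u'f : u^† * f = 0 by rewrite -{1}fE -dagM fu dag0.
by split; rewrite ?dagD ?fE !(mulrDl, mulrDr) ff ?(fu, uf, fu', u'f, fg, gf)
  ?(gu, ug, u1, u2) !(addr0, add0r).
Qed.

(** The images of [e] and [e^†] are complementary lagrangians of the hyperbolic space onto which
    [hyp e] projects. *)
Definition isotropic_idem e := [/\ e * e = e, e * e^† = 0 & e^† * e = 0].

Lemma isotropic_idem_dag e : isotropic_idem e -> isotropic_idem e^†.
Proof. by move=> [ee ee' e'e]; split; rewrite ?dagK // -dagM ee. Qed.

Definition orth_complement e k :=
  [/\ k * k = k, k^† = k, e * k = 0 & k * e = 0].

Lemma orth_complement_dag e k :
  orth_complement e k -> orth_complement e^† k.
Proof.
move=> [kk kE ek ke]; split=> //; first by rewrite -{1}kE -dagM ke dag0.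
by rewrite -{1}kE -dagM ek dag0.
Qed.

Definition hyp e := e + e^†.

Lemma hyp_dag e : (hyp e)^† = hyp e.
Proof. by rewrite dagD dagK addrC. Qed.

Definition partial_isometry f g v := [/\ v^† * v = f, v * f = v & g * v = v].

Lemma partial_isometryM f g u v :
  unitary_on g u -> partial_isometry f g v -> partial_isometry f g (u * v).
Proof.
move=> [gu ug u1 _] [vv vf gv]; split.
- by rewrite dagM -mulrA (mulrA _ u) u1 gv.
- by rewrite -mulrA vf.
- by rewrite mulrA gu.
Qed.

Definition extends_to_unitary f g v := exists2 u, unitary_on g u & u * f = v.

Lemma extends_to_unitaryM f g u v : g^† = g -> unitary_on g u -> g * v = v ->
  extends_to_unitary f g (u * v) -> extends_to_unitary f g v.
Proof.
move=> gE ug gv [w wg wf]; exists (u^† * w).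
  exact: (unitary_onM (unitary_on_dag gE ug)).
by rewrite -mulrA wf mulrA; case: ug => _ _ -> _.
Qed.

(** The complement [k] is arbitrary so that, for a sum of two idempotents, the hyperbolic part of
    the second can be absorbed into the complement of the first. *)
Definition witt_extension e := forall k v, orth_complement e k ->
  partial_isometry (hyp e) (hyp e + k) v ->
  extends_to_unitary (hyp e) (hyp e + k) v.

(** Orthogonality of [e], [e^†] and [k] kills every product that arises between T, c and their
    adjoints except T T^†, which c + c^† cancels. *)
Lemma eichler_unitary g e k T c :
    g^† = g -> g * g = g -> g * e = e -> g * k = k -> isotropic_idem e ->
    orth_complement e k ->
    e * T = T -> T * k = T -> e * c = c -> c * e^† = c ->
    c + c^† = - (T * T^†) ->
  unitary_on g (g + T - T^† + c).
Proof.
move=> gE gg ge gk [ee ee' e'e] [kk kE ek ke] eT Tk ec ce' cc.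
have e'k : e^† * k = 0 by rewrite -{1}kE -dagM ke dag0.
have kg : k * g = k by rewrite -{1}kE -{1}gE -dagM gk kE.
have e'g : e^† * g = e^† by rewrite -{1}gE -dagM ge.
have T'e' : T^† * e^† = T^† by rewrite -dagM eT.
have kT' : k * T^† = T^† by rewrite -{1}kE -dagM Tk.
have c'e' : c^† * e^† = c^† by rewrite -dagM ec.
have ec' : e * c^† = c^† by rewrite -{1}(dagK e) -dagM ce'.
have gT : g * T = T by rewrite -eT mulrA ge.
have Tg : T * g = T by rewrite -Tk -mulrA kg.
have gc : g * c = c by rewrite -ec mulrA ge.
have cg : c * g = c by rewrite -ce' -mulrA e'g.
have gT' : g * T^† = T^† by rewrite -{1}gE -dagM Tg.
have T'g : T^† * g = T^† by rewrite -{1}gE -dagM gT.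
have gc' : g * c^† = c^† by rewrite -{1}gE -dagM cg.
have c'g : c^† * g = c^† by rewrite -{1}gE -dagM gc.
have TT : T * T = 0 by apply: mul_orth Tk eT ke.
have T'T' : T^† * T^† = 0 by apply: mul_orth T'e' kT' e'k.
have T'T : T^† * T = 0 by apply: mul_orth T'e' eT e'e.
have Tc : T * c = 0 by apply: mul_orth Tk ec ke.
have Tc' : T * c^† = 0 by apply: mul_orth Tk ec' ke.
have T'c : T^† * c = 0 by apply: mul_orth T'e' ec e'e.
have T'c' : T^† * c^† = 0 by apply: mul_orth T'e' ec' e'e.
have cT : c * T = 0 by apply: mul_orth ce' eT e'e.
have cT' : c * T^† = 0 by apply: mul_orth ce' kT' e'k.
have c'T : c^† * T = 0 by apply: mul_orth c'e' eT e'e.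
have c'T' : c^† * T^† = 0 by apply: mul_orth c'e' kT' e'k.
have c0 : c * c^† = 0 by apply: mul_orth ce' ec' e'e.
have c'0 : c^† * c = 0 by apply: mul_orth c'e' ec e'e.
have fin : g + (T^† - T + c^†) + (T - T^† + c) + T * T^† = g.
  rewrite -(addrA g) -(addrA g) addrACA -(opprB T) addNr add0r.
  by rewrite (addrC c^†) cc addNr addr0.
have dagE : (g + T - T^† + c)^† = g + (T^† - T + c^†).
  by rewrite !dagD dagN dagK gE !addrA.
rewrite /unitary_on dagE -(addrA g) -(addrA g).
have gY : g * (T - T^† + c) = T - T^† + c.
  by rewrite !mulrDr mulrN gT gT' gc.
have Yg : (T - T^† + c) * g = T - T^† + c.
  by rewrite !mulrDl mulNr Tg T'g cg.
have Xg : (T^† - T + c^†) * g = T^† - T + c^†.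
  by rewrite !mulrDl mulNr Tg T'g c'g.
have gX : g * (T^† - T + c^†) = T^† - T + c^†.
  by rewrite !mulrDr mulrN gT gT' gc'.
split.
- by rewrite mulrDr gg gY.
- by rewrite mulrDl gg Yg.
- rewrite -[RHS]fin mulrDr mulrDl gg Xg mulrDl gY addrA; congr (_ + _).
  rewrite !(mulrDl, mulrDr) !(mulrN, mulNr) T'T T'T' T'c TT Tc c'T c'T' c'0.
  by rewrite !(oppr0, opprK, add0r, addr0).
- rewrite -[RHS]fin [in RHS](addrAC g) mulrDr mulrDl gg Yg mulrDl gX addrA;
    congr (_ + _).
  rewrite !(mulrDl, mulrDr) !(mulrN, mulNr) TT Tc' T'T T'T' T'c' cT cT' c0.
  by rewrite !(oppr0, opprK, add0r, addr0).
Qed.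

(** The Eichler transformation is taken relative to [e^†]. Its data are read off from x = e + e^† x
    + k x: the term -T^† removes k x, and [c] removes e^† x together with the new term T x. *)
Lemma eichler_transitive g e k x : g = hyp e + k ->
    isotropic_idem e -> orth_complement e k ->
    x * e = x -> g * x = x -> e * x = e -> x^† * x = 0 ->
  exists u, [/\ unitary_on g u, u * x = e & u * e^† = e^†].
Proof.
move=> gdef eI kO xe gx ex xx.
have [ee ee' e'e] := eI; have [kk kE ek ke] := kO.
have [e'e' _ _] := isotropic_idem_dag eI.
have [_ _ e'k ke'] := orth_complement_dag kO.
have gE : g^† = g by rewrite gdef dagD hyp_dag kE.
have ge : g * e = e by rewrite gdef /hyp !mulrDl ee e'e ke !addr0.
have ge' : g * e^† = e^† by rewrite gdef /hyp !mulrDl ee' e'e' ke' add0r addr0.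
have gk : g * k = k by rewrite gdef /hyp !mulrDl ek e'k kk !add0r.
have gg : g * g = g by rewrite {2}gdef /hyp !mulrDr ge ge' gk -gdef.
have x'e' : e^† * x^† = x^† by rewrite -dagM xe.
have xidem : x * x = x by rewrite -{1}xe -mulrA ex xe.
pose T := x^† * k; pose c := - (e^† * x + x^† * k * x).
have T'E : T^† = k * x by rewrite dagM dagK kE.
have iso : x^† * e^† = e^† by rewrite -dagM ex.
have q' : (e^† * x)^† = x^† * e by rewrite dagM dagK.
(* The isotropy of [x], expanded along g = e + e^† + k; it gives the condition on c + c^†. *)
have xgx : x^† * e + e^† * x + x^† * k * x = 0.
  rewrite -xx -[X in _ = _ * X]gx gdef /hyp !mulrDl !mulrDr !mulrA iso.
  by rewrite -(mulrA _ e) ex.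
have uU : unitary_on g (g + T - T^† + c).
  apply: (@eichler_unitary g e^† k) => //.
  - exact: isotropic_idem_dag.
  - by rewrite /T mulrA x'e'.
  - by rewrite /T -mulrA kk.
  - by rewrite /c mulrN mulrDr !mulrA e'e' x'e'.
  - by rewrite dagK /c mulNr mulrDl -!mulrA xe.
  - rewrite T'E /T /c dagN dagD q' !dagM dagK kE.
    rewrite [in RHS]mulrA -(mulrA _ k k) kk (mulrA x^†).
    have -> : e^† * x + x^† * k * x = - (x^† * e).
      by apply/eqP; rewrite -addr_eq0 addrC addrA xgx.
    by rewrite opprK opprD addrA subrr add0r.
exists (g + T - T^† + c); split=> //.
- have xE : x = e + e^† * x + k * x by rewrite -{1}gx gdef !mulrDl ex.
  rewrite T'E /T /c !mulrDl !mulNr !mulrDl -!(mulrA _ _ x) xidem gx {1}xE.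
  by rewrite (addrAC _ (k * x)) addrK -(addrA e) addrK.
- rewrite T'E /T /c !mulrDl !mulNr !mulrDl ge'.
  have xe' : x * e^† = 0 by rewrite -xe -mulrA ee' mulr0.
  by rewrite -!mulrA xe' ke' !mulr0 !(addr0, subr0).
Qed.

(** * Extending partial isometries for a fixed isotropic idempotent *)

Section Frame.
Variables e k : E.
Hypothesis eI : isotropic_idem e.
Hypothesis kO : orth_complement e k.
Let f := hyp e.
Let g := hyp e + k.

Let ee : e * e = e. Proof. by case: eI. Qed.
Let ee' : e * e^† = 0. Proof. by case: eI. Qed.
Let e'e : e^† * e = 0. Proof. by case: eI. Qed.
Let e'e' : e^† * e^† = e^†. Proof. by rewrite -dagM ee. Qed.
Let kk : k * k = k. Proof. by case: kO. Qed.
Let kE : k^† = k. Proof. by case: kO. Qed.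
Let ek : e * k = 0. Proof. by case: kO. Qed.
Let ke : k * e = 0. Proof. by case: kO. Qed.
Let e'k : e^† * k = 0. Proof. by case: (orth_complement_dag kO). Qed.
Let ke' : k * e^† = 0. Proof. by case: (orth_complement_dag kO). Qed.

Let gE : g^† = g. Proof. by rewrite dagD hyp_dag kE. Qed.
Let ge : g * e = e.
Proof. by rewrite /g /hyp !mulrDl ee e'e ke !addr0. Qed.
Let eg : e * g = e.
Proof. by rewrite /g /hyp !mulrDr ee ee' ek !addr0. Qed.
Let ge' : g * e^† = e^†.
Proof. by rewrite -{1}gE -dagM eg. Qed.
Let gk : g * k = k.
Proof. by rewrite /g /hyp !mulrDl ek e'k kk !add0r. Qed.
Let kg : k * g = k.
Proof. by rewrite -{1}kE -{1}gE -dagM gk kE. Qed.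
Let e'g : e^† * g = e^†.
Proof. by rewrite -{1}gE -dagM ge. Qed.
Let gg : g * g = g.
Proof. by rewrite {2}/g /hyp !mulrDr ge ge' gk. Qed.
Let ff : f * f = f.
Proof. by rewrite /f /hyp mulrDl !mulrDr ee e'e ee' e'e' add0r addr0. Qed.

(** One Eichler transformation moves v e to [e]. Since the resulting [v1] fixes [e] and is
    isometric, e^† v1 e^† = e^†, so a second one, with the lagrangians exchanged, moves v1 e^† to
    [e^†] while fixing [e]. *)
Lemma extends_of_corner v : partial_isometry f g v -> e * v * e = e ->
  extends_to_unitary f g v.
Proof.
move=> vI eve; have [vv vf gv] := vI.
have fe : f * e = e by rewrite /f /hyp mulrDl ee e'e addr0.
have fe' : f * e^† = e^† by rewrite /f /hyp mulrDl ee' e'e' add0r.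
have [||||u1 [u1U u1e u1e']] := @eichler_transitive g e k (v * e) erefl eI kO.
- by rewrite -mulrA ee.
- by rewrite mulrA gv.
- by rewrite mulrA.
- by rewrite dagM -mulrA (mulrA v^†) vv fe.
have [v1v1 v1f gv1] := partial_isometryM u1U vI.
pose v1 := u1 * v; rewrite -/v1 in v1v1 v1f gv1.
have v1e : v1 * e = e by rewrite -mulrA.
have [|||||u2 [u2U u2e u2e']] := @eichler_transitive g e^† k (v1 * e^†) _
  (isotropic_idem_dag eI) (orth_complement_dag kO).
- by rewrite /g /hyp dagK (addrC e^†).
- by rewrite -mulrA e'e'.
- by rewrite mulrA gv1.
- by rewrite -{1}v1e dagM -mulrA (mulrA v1^†) v1v1 fe'.
- by rewrite dagM -mulrA (mulrA v1^†) v1v1 fe' dagK.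
rewrite dagK in u2e'.
apply: (extends_to_unitaryM gE u1U) => //.
apply: (extends_to_unitaryM gE u2U) => //.
exists g; first by split; rewrite ?gE.
rewrite -/v1 -[in RHS]v1f /f /hyp !mulrDr ge ge' v1e u2e' u2e //.
Qed.

(** The unitary w = r + y^† + k normalises the corner: e w v e = e. For a = e^† it interchanges the
    two lagrangians. *)
Lemma extends_of_invertible_corner a r v : a = e \/ a = e^† ->
    partial_isometry f g v -> e * r = r -> r * a = r ->
    r * (a * v * e) = e -> a * v * e * r = a ->
  extends_to_unitary f g v.
Proof.
move=> aE vI er ra ry yr.
have aa : a * a = a by case: aE => ->.
have aa' : a * a^† = 0 by case: aE => ->; rewrite ?dagK.
have a'a : a^† * a = 0 by case: aE => ->; rewrite ?dagK.
have ak : a * k = 0 by case: aE => ->.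
have ka : k * a = 0 by case: aE => ->.
have fa : a + a^† = f by case: aE => ->; rewrite ?dagK // addrC.
have ga : g * a = a by case: aE => ->.
have ga' : g * a^† = a^† by case: aE => ->; rewrite ?dagK.
have ag : a * g = a by case: aE => ->.
set y := a * v * e in ry yr.
have ay : a * y = y by rewrite !mulrA aa.
have ye : y * e = y by rewrite -mulrA ee.
pose w := r + y^† + k.
have e'r' : r^† * e^† = r^† by rewrite -dagM er.
have a'r' : a^† * r^† = r^† by rewrite -dagM ra.
have y'a' : y^† * a^† = y^† by rewrite -dagM ay.
have e'y' : e^† * y^† = y^† by rewrite -dagM ye.
have r'y' : r^† * y^† = a^† by rewrite -dagM yr.
have y'r' : y^† * r^† = e^† by rewrite -dagM ry.
have rr' : r * r^† = 0 by apply: mul_orth ra a'r' aa'.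
have r'r : r^† * r = 0 by apply: mul_orth e'r' er e'e.
have yy' : y * y^† = 0 by apply: mul_orth ye e'y' ee'.
have y'y : y^† * y = 0 by apply: mul_orth y'a' ay a'a.
have kr : k * r = 0 by rewrite -er mulrA ke mul0r.
have rk : r * k = 0 by rewrite -ra -mulrA ak mulr0.
have ky : k * y = 0 by rewrite -ay mulrA ka mul0r.
have yk : y * k = 0 by rewrite -ye -mulrA ek mulr0.
have ky' : k * y^† = 0 by rewrite -{1}kE -dagM yk dag0.
have y'k : y^† * k = 0 by rewrite -{1}kE -dagM ky dag0.
have kr' : k * r^† = 0 by rewrite -{1}kE -dagM rk dag0.
have r'k : r^† * k = 0 by rewrite -{1}kE -dagM kr dag0.
have w'E : w^† = r^† + y + k by rewrite !dagD dagK kE.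
have wU : unitary_on g w.
  split.
  - have gr : g * r = r by rewrite -er mulrA ge.
    have gy' : g * y^† = y^† by rewrite -e'y' mulrA ge'.
    by rewrite !mulrDr gk gr gy'.
  - have rg : r * g = r by rewrite -ra -mulrA ag.
    have y'g : y^† * g = y^† by rewrite -y'a' -mulrA -{1}gE -dagM ga.
    by rewrite !mulrDl kg rg y'g.
  - rewrite w'E !(mulrDl, mulrDr) r'r r'y' r'k yr yy' yk kr ky' kk.
    by rewrite !(addr0, add0r) /g -/f -fa (addrC a).
  - rewrite w'E !(mulrDl, mulrDr) rr' ry rk y'r' y'y y'k kr' ky kk.
    by rewrite !(addr0, add0r).
apply: (extends_to_unitaryM gE wU); first by case: vI.
apply: extends_of_corner; first exact: (partial_isometryM wU).
have ew : e * w = r by rewrite !mulrDr er ek -e'y' mulrA ee' mul0r !addr0.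
by rewrite mulrA ew -ra -[RHS]ry !mulrA.
Qed.

Section Local.
Variable h : E.
Hypotheses (eh : e * h = h) (hh : h + h = e).

Definition inverse_in a x y :=
  [/\ a * y = y, y * a = y, y * x = a & x * y = a].

Hypothesis e_local : forall x, e * x = x -> x * e = x ->
  (exists y, inverse_in e x y) \/ (exists y, inverse_in e (e - x) y).

Lemma local_idem s : e * s = s -> s * e = s -> s * s = s -> s = e \/ s = 0.
Proof.
move=> es se ss; have [[y [ey ye ys sy]]|[y [ey ye ys sy]]] := e_local es se.
  by left; rewrite -sy -[in RHS]ss -mulrA sy.
by right; rewrite -es -ys -mulrA mulrBl es ss subrr mulr0.
Qed.

(** The product y r a is an idempotent of the corner at [a], hence [a] or 0 by locality, applied to
    its adjoint when a = e^†. It is 0 only if e = 0, and then [a] is 0 too. *)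
Lemma local_linv_inv a y r : a = e \/ a = e^† ->
    a * y = y -> y * e = y -> e * r = r -> r * y = e ->
  [/\ e * (r * a) = r * a, r * a * a = r * a, r * a * y = e & y * (r * a) = a].
Proof.
move=> aE ay ye er ry.
have aa : a * a = a by case: aE => ->.
have ray : r * a * y = e by rewrite -mulrA ay.
split=> //; rewrite ?mulrA ?er // -?mulrA ?aa // mulrA.
have ss : (y * r * a) * (y * r * a) = y * r * a.
  by rewrite -!mulrA (mulrA a) ay (mulrA r y) ry (mulrA e) er.
have s0 : y * r * a = 0 -> y * r * a = a.
  move=> yra0; have y0 : y = 0 by rewrite -ye -ray !mulrA yra0 mul0r.
  have e0 : e = 0 by rewrite -ry y0 mulr0.
  by rewrite yra0; case: aE => ->; rewrite e0 ?dag0.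
have as_ : a * (y * r * a) = y * r * a by rewrite !mulrA ay.
have sa : (y * r * a) * a = y * r * a by rewrite -mulrA aa.
move: (y * r * a) ss s0 as_ sa => s ss s0 as_ sa.
case: aE as_ sa s0 => -> as_ sa s0.
  by have [|/s0] := local_idem as_ sa ss.
have [|||s'e|s'0] := @local_idem s^†.
- by rewrite -{1}(dagK e) -dagM sa.
- by rewrite -{1}(dagK e) -dagM as_.
- by rewrite -dagM ss.
- by rewrite -s'e dagK.
- by rewrite s0 // -(dagK s) s'0 dag0.
Qed.

(** Factor z + x = z (e + z' x): if z' x were invertible, [x] would have a left inverse. Having no
    left inverse is the convenient notion of non-unit because it persists under left
    multiplication. *)
Lemma local_add z z' x : inverse_in e z z' -> e * z = z -> z * e = z ->
    e * x = x -> x * e = x -> (forall r, e * r = r -> r * x <> e) ->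
  exists y, inverse_in e (z + x) y.
Proof.
move=> [ez' z'e z'z zz'] ez ze ex xe xN.
have [||[y [ey ye yx _]]|[y [ey ye yx xy]]] := @e_local (- (z' * x)).
- by rewrite mulrN mulrA ez'.
- by rewrite mulNr -mulrA xe.
- case: (xN (- (y * z'))); first by rewrite mulrN mulrA ey.
  by rewrite -yx mulrN mulNr mulrA.
have zxE : z + x = z * (e - - (z' * x)).
  by rewrite opprK mulrDr ze mulrA zz' ex.
exists (y * z'); split.
- by rewrite mulrA ey.
- by rewrite -mulrA z'e.
- by rewrite zxE -mulrA (mulrA z') z'z (mulrA y) ye.
- by rewrite zxE -mulrA (mulrA _ y) xy ez' zz'.
Qed.

(** If e v e or e^† v e has a left inverse, the invertible case applies. Otherwise e = e v^† v e,
    expanded along [g], exhibits m = e v^† k v e as [e] plus two non-units, hence as a unit, and an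
    Eichler transformation built from its inverse makes e v e a unit. *)
Lemma extends_of_local v : partial_isometry f g v -> extends_to_unitary f g v.
Proof.
move=> vI; have [vv vf gv] := vI.
have corner a v1 : a = e \/ a = e^† -> partial_isometry f g v1 ->
    (exists2 r, e * r = r & r * (a * v1 * e) = e) -> extends_to_unitary f g v1.
  move=> aE v1I [r er ry].
  have [||ra1 ra2 ra3 ra4] := local_linv_inv aE _ _ er ry.
  - by case: aE => ->; rewrite !mulrA ?ee ?e'e'.
  - by rewrite -mulrA ee.
  exact: (extends_of_invertible_corner aE v1I ra1 ra2).
have [linv_p|p_nonunit] := pselect (exists2 r, e * r = r & r * (e * v * e) = e).
  by apply: (corner e) => //; left.
have [linv_q|q_nonunit] := pselect (exists2 r, e * r = r & r * (e^† * v * e) = e).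
  by apply: (corner e^†) => //; right.
have pN r : e * r = r -> r * (e * v * e) <> e
    by move=> er ry; case: p_nonunit; exists r.
have qN r : e * r = r -> r * (e^† * v * e) <> e
    by move=> er ry; case: q_nonunit; exists r.
have fe : f * e = e by rewrite /f /hyp mulrDl ee e'e addr0.
set m := e * v^† * k * v * e.
have eI' : inverse_in e e e by split.
have NM y P : (forall r, e * r = r -> r * y <> e) ->
    forall r, e * r = r -> r * (P * y) <> e.
  by move=> yN r er; rewrite mulrA; apply: yN; rewrite mulrA er.
have ep : e * (e * v * e) = e * v * e by rewrite !mulrA ee.
have pe : e * v * e * e = e * v * e by rewrite -mulrA ee.
have qe : e^† * v * e * e = e^† * v * e by rewrite -mulrA ee.
pose x1 := - (e * v^†) * (e * v * e); pose x2 := - (e * v^†) * (e^† * v * e).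
have ex1 : e * x1 = x1 by rewrite /x1 mulNr mulrN !mulrA ee.
have ex2 : e * x2 = x2 by rewrite /x2 mulNr mulrN !mulrA ee.
have x1e : x1 * e = x1 by rewrite -mulrA pe.
have x2e : x2 * e = x2 by rewrite -mulrA qe.
have mE : m = e + x1 + x2.
  rewrite /x1 /x2 !mulNr -addrA -opprD; apply/eqP; rewrite eq_sym subr_eq.
  rewrite {1}(_ : e = e * (v^† * (g * v)) * e); last first.
    by rewrite gv vv -mulrA fe ee.
  by rewrite /g /hyp !mulrDl !mulrDr !mulrDl !mulrA addrC.
have [u [eu ue um mu]] : exists u, inverse_in e m u.
  rewrite mE; have [y yI] := local_add eI' ee ee ex1 x1e (NM _ _ pN).
  apply: (local_add yI) => //; last exact: NM.
    by rewrite mulrDr ee ex1.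
  by rewrite mulrDl ee x1e.
(* Chosen so that T v e = u m = e. *)
pose T := u * e * v^† * k.
have eT : e * T = T by rewrite /T !mulrA eu.
have Tk : T * k = T by rewrite /T -!mulrA kk.
have Tve : T * v * e = e by rewrite -[RHS]um /m /T !mulrA.
move: T eT Tk Tve => T eT Tk Tve; pose c := - (h * T * T^†).
have T'e' : T^† * e^† = T^† by rewrite -dagM eT.
have ec : e * c = c by rewrite /c mulrN !mulrA eh.
have ce' : c * e^† = c by rewrite /c mulNr -!mulrA T'e'.
have uU : unitary_on g (g + T - T^† + c).
  apply: (@eichler_unitary g e k) => //.
  have hT : h * T + h * T = T by rewrite -mulrDl hh.
  have T'h : T^† * h^† + T^† * h^† = T^† by rewrite -!dagM -dagD hT.
  (* Doubling either half in h T T^† h^† shows that the two ways of halving T T^† agree; hence c +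
     c^† = -T T^†. *)
  have hTT : h * T * T^† = T * T^† * h^†.
    have : h * T * (T^† * h^† + T^† * h^†) = (h * T + h * T) * (T^† * h^†).
      by rewrite mulrDr mulrDl.
    by rewrite T'h hT mulrA.
  by rewrite /c dagN !dagM dagK (mulrA T) -opprD -hTT -mulrDl hT.
apply: (extends_to_unitaryM gE uU) => //.
apply: (corner e); first by left.
  exact: partial_isometryM.
have eT' : e * T^† = 0 by rewrite -Tk dagM kE mulrA ek mul0r.
(* The transformed corner is the unit [e] plus two non-units, the last one being a left multiple of
   e^† v e, so it is a unit by locality. *)
have -> : e * ((g + T - T^† + c) * v) * e = e + e * v * e + c * (e^† * v * e).
  rewrite 3!mulrDl gv mulNr !mulrDr !mulrDl mulrN mulNr !mulrA eT' !mul0r oppr0 addr0.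
  by rewrite eT Tve ec ce' (addrC e).
have [y yI] := local_add eI' ee ee ep pe pN.
have [||||y' [ey' _ y'e _]] := local_add yI _ _ _ _ (NM _ c qN); last by exists y'.
- by rewrite mulrDr ee ep.
- by rewrite mulrDl ee pe.
- by rewrite mulrA ec.
- by rewrite -mulrA qe.
Qed.

End Local.
End Frame.

Lemma witt_extension_local e h :
    isotropic_idem e -> e * h = h -> h + h = e ->
    (forall x, e * x = x -> x * e = x ->
      (exists y, inverse_in e x y) \/ (exists y, inverse_in e (e - x) y)) ->
  witt_extension e.
Proof. by move=> eI eh hh eL k v kO; apply: extends_of_local hh eL _. Qed.

(** * Additivity of the extension property and reduction to local idempotents *)

Lemma isotropic_idem_sub e e1 : isotropic_idem e ->
  e * e1 = e1 -> e1 * e = e1 -> e1 * e1 = e1 -> isotropic_idem e1.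
Proof.
move=> [ee ee' e'e] ee1 e1e e1e1; split=> //.
  by apply: (mul_orth e1e _ ee'); rewrite -dagM e1e.
by apply: (mul_orth _ ee1 e'e); rewrite -dagM ee1.
Qed.

(** Extend [v] on [hyp e1] by a unitary and divide it out. The rest fixes [hyp e1], so it carries
    [hyp e2] into the corner at hyp e2 + k, where it extends again; the two unitaries are then
    glued. *)
Lemma witt_extensionD e1 e2 : isotropic_idem (e1 + e2) ->
    e1 * e1 = e1 -> e2 * e2 = e2 -> e1 * e2 = 0 -> e2 * e1 = 0 ->
  witt_extension e1 -> witt_extension e2 -> witt_extension (e1 + e2).
Proof.
move=> eI e11 e22 e12 e21 W1 W2 k v [kk kE ek ke] vI.
set e := e1 + e2 in eI ek ke vI *.
have [ee ee' e'e] := eI.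
have ee1 : e * e1 = e1 by rewrite /e mulrDl e11 e21 addr0.
have e1e : e1 * e = e1 by rewrite /e mulrDr e11 e12 addr0.
have ee2 : e * e2 = e2 by rewrite /e mulrDl e12 e22 add0r.
have e2e : e2 * e = e2 by rewrite /e mulrDr e21 e22 add0r.
have [_ e11' e1'1] := isotropic_idem_sub eI ee1 e1e e11.
have [_ e22' e2'2] := isotropic_idem_sub eI ee2 e2e e22.
have e'e1' : e^† * e1^† = e1^† by rewrite -dagM e1e.
have e'e2' : e^† * e2^† = e2^† by rewrite -dagM e2e.
have e1'e' : e1^† * e^† = e1^† by rewrite -dagM ee1.
have e2'e' : e2^† * e^† = e2^† by rewrite -dagM ee2.
have e12' : e1 * e2^† = 0 by apply: mul_orth e1e e'e2' ee'.
have e21' : e2 * e1^† = 0 by apply: mul_orth e2e e'e1' ee'.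
have e1'2 : e1^† * e2 = 0 by apply: mul_orth e1'e' ee2 e'e.
have e2'1 : e2^† * e1 = 0 by apply: mul_orth e2'e' ee1 e'e.
have e1'2' : e1^† * e2^† = 0 by rewrite -dagM e21 dag0.
have e2'1' : e2^† * e1^† = 0 by rewrite -dagM e12 dag0.
have e11d : e1^† * e1^† = e1^† by rewrite -dagM e11.
have e22d : e2^† * e2^† = e2^† by rewrite -dagM e22.
have e1k : e1 * k = 0 by rewrite -e1e -mulrA ek mulr0.
have e2k : e2 * k = 0 by rewrite -e2e -mulrA ek mulr0.
have ke1 : k * e1 = 0 by rewrite -ee1 mulrA ke mul0r.
have ke2 : k * e2 = 0 by rewrite -ee2 mulrA ke mul0r.
have fE : hyp e = hyp e1 + hyp e2 by rewrite /hyp /e dagD addrACA.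
have f11 : hyp e1 * hyp e1 = hyp e1.
  by rewrite /hyp !mulrDl !mulrDr e11 e11' e1'1 e11d addr0 add0r.
have f22 : hyp e2 * hyp e2 = hyp e2.
  by rewrite /hyp !mulrDl !mulrDr e22 e22' e2'2 e22d addr0 add0r.
have f12 : hyp e1 * hyp e2 = 0.
  by rewrite /hyp !mulrDl !mulrDr e12 e12' e1'2 e1'2' !addr0.
have f21 : hyp e2 * hyp e1 = 0.
  by rewrite /hyp !mulrDl !mulrDr e21 e21' e2'1 e2'1' !addr0.
have kO2 : orth_complement e2 k by [].
have f2k : hyp e2 * k = 0.
  by rewrite /hyp mulrDl e2k add0r -{1}kE -dagM ke2 dag0.
have kf2 : k * hyp e2 = 0.
  by rewrite /hyp mulrDr ke2 add0r -{1}kE -dagM e2k dag0.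
have f1k : hyp e1 * k = 0.
  by rewrite /hyp mulrDl e1k add0r -{1}kE -dagM ke1 dag0.
have kO1 : orth_complement e1 (hyp e2 + k).
  split.
  - by rewrite mulrDl mulrDr (mulrDr k) f22 f2k kf2 kk addr0 add0r.
  - by rewrite dagD hyp_dag kE.
  - by rewrite /hyp !mulrDr e12 e12' e1k !addr0.
  - by rewrite /hyp !mulrDl e21 e2'1 ke1 !addr0.
have gE : hyp e1 + (hyp e2 + k) = hyp e + k by rewrite fE addrA.
have gs : (hyp e + k)^† = hyp e + k by rewrite dagD hyp_dag kE.
have [vv vf gv] := vI.
have ff1 : hyp e * hyp e1 = hyp e1 by rewrite fE mulrDl f11 f21 addr0.
have f1f : hyp e1 * hyp e = hyp e1 by rewrite fE mulrDr f11 f12 addr0.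
have ff2 : hyp e * hyp e2 = hyp e2 by rewrite fE mulrDl f12 f22 add0r.
have f2f : hyp e2 * hyp e = hyp e2 by rewrite fE mulrDr f21 f22 add0r.
have [|u1 u1U u1f] := W1 _ (v * hyp e1) kO1.
  split.
  - by rewrite dagM hyp_dag -mulrA (mulrA v^†) vv ff1 f11.
  - by rewrite -mulrA f11.
  - by rewrite gE mulrA gv.
rewrite gE in u1U; have [gu1 u1g u1u1 u11] := u1U.
have u1s := unitary_on_dag gs u1U; pose v1 := u1^† * v.
have [v1v1 v1f gv1] := partial_isometryM u1s vI; rewrite -/v1 in v1v1 v1f gv1.
have gf1 : (hyp e + k) * hyp e1 = hyp e1.
  by rewrite -gE mulrDl f11 mulrDl f21 -[k in k * _]kE -(hyp_dag e1) -dagM f1k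
      dag0 !addr0.
have v1f1 : v1 * hyp e1 = hyp e1 by rewrite /v1 -mulrA -u1f mulrA u1u1.
(* Adjoint form of the previous equation, using v1^† v1 = hyp e; it keeps the image of [hyp e2] away
   from [hyp e1]. *)
have f1v1 : hyp e1 * v1 = hyp e1.
  by rewrite -[X in X * v1]hyp_dag -{1}v1f1 dagM hyp_dag -mulrA v1v1 f1f.
have kf1 : k * hyp e1 = 0 by rewrite -kE -(hyp_dag e1) -dagM f1k dag0.
have f1g2 : hyp e1 * (hyp e2 + k) = 0 by rewrite mulrDr f12 f1k addr0.
have g2f1 : (hyp e2 + k) * hyp e1 = 0 by rewrite mulrDl f21 kf1 addr0.
have g2v1 : (hyp e2 + k) * v1 = v1 - hyp e1.
  by rewrite -[in RHS]gv1 -gE [in RHS]mulrDl f1v1 [RHS]addrC addKr.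
have [|u2 u2U u2f] := W2 _ (v1 * hyp e2) kO2.
  split.
  - by rewrite dagM hyp_dag -mulrA (mulrA v1^†) v1v1 ff2 f22.
  - by rewrite -mulrA f22.
  - by rewrite mulrA g2v1 mulrBl f12 subr0.
have u2f1 : u2 * hyp e1 = 0.
  by case: u2U => _ <- _ _; rewrite -mulrA g2f1 mulr0.
exists (u1 * (hyp e1 + u2)).
  by apply: unitary_onM => //; rewrite -gE; apply: unitary_onD; rewrite ?hyp_dag.
have <- : u1 * v1 = v by rewrite mulrA u11 gv.
rewrite -mulrA; congr (_ * _); rewrite -[RHS]v1f fE mulrDl.
rewrite (mulrDr (hyp e1)) (mulrDr u2) (mulrDr v1).
by rewrite f11 f12 u2f1 u2f v1f1 add0r addr0.
Qed.

(** The inverse is the finite geometric series, cut down to the corner by [e]. *)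
Lemma nilpotent_inverse_in e x n : e * e = e -> e * x = x -> x * e = x ->
  x ^+ n = 0 -> exists y, inverse_in e (e - x) y.
Proof.
move=> ee ex xe xn0; pose t := \sum_(i < n) x ^+ i.
have xt : x * t = t * x by apply: commr_sum => i _; apply: commrX.
have et : e * t = t * e.
  by apply: commr_sum => i _; apply: commrX; rewrite /GRing.comm ex xe.
have t1 : (1 - x) * t = 1 by rewrite -opprB mulNr -subrX1 xn0 sub0r opprK.
have t2 : t * (1 - x) = 1 by rewrite mulrBr mulr1 -xt -[in X in X - _](mul1r t) -mulrBl.
have exl : e - x = e * (1 - x) by rewrite mulrBr mulr1 ex.
have exr : e - x = (1 - x) * e by rewrite mulrBl mul1r xe.
exists (e * t); split.
- by rewrite mulrA ee.
- by rewrite -mulrA -et mulrA ee.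
- by rewrite exl mulrA -(mulrA e) -et mulrA ee -mulrA t2 mulr1.
- by rewrite exr mulrA -(mulrA _ e e) ee -exr exl -mulrA t1 mulr1.
Qed.

(* The corner e E e need not have finite length, but it is strongly pi-regular
   and has no infinite orthogonal family of idempotents; hence e is a finite sum
   of local idempotents. *)
Theorem witt_extension_pi_regular e h :
    isotropic_idem e -> h + h = e ->
    (forall x, e * x = x -> x * e = x -> exists n y,
      x ^+ n.+1 * y = y * x ^+ n.+1 /\ x ^+ n.+1 * y * x ^+ n.+1 = x ^+ n.+1) ->
    (forall d : nat -> E, (forall n, e * d n = d n) ->
      (forall n, d n * e = d n) -> (forall n, d n * d n = d n) ->
      (forall m n, m != n -> d m * d n = 0) -> exists n, d n = 0) ->
  witt_extension e.
Proof.
move=> eI hh regular fin; have [ee _ _] := eI.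
pose sub e1 e2 := [/\ e2 * e1 = e1, e1 * e2 = e1 & e1 * e1 = e1].
have subT e1 e2 e3 : sub e1 e2 -> sub e2 e3 -> sub e1 e3.
  move=> [a1 a2 a3] [b1 b2 b3]; split=> //; first by rewrite -a1 mulrA b1.
  by rewrite -a2 -mulrA b2.
(* Suppose the property holds strictly below [e1]. If [e1] splits, additivity gives it for [e1]; if
   not, [e1] turns out to be local. *)
have step e1 : sub e1 e -> ~ witt_extension e1 ->
    exists e2, [/\ sub e2 e1, e2 <> e1 & ~ witt_extension e2].
  move=> se1 W1; have [ee1 e1e e11] := se1.
  have e1I := isotropic_idem_sub eI ee1 e1e e11.
  apply: contrapT => noE.
  have W e2 : sub e2 e1 -> e2 <> e1 -> witt_extension e2.
    by move=> s21 e21; apply: contrapT => W2; apply: noE; exists e2.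
  apply: W1; have [[p [sp p0 p1]]|triv] := pselect (exists p, [/\ sub p e1, p <>
      0 & p <> e1]).
    have [e1p pe1 pp] := sp.
    have qq : (e1 - p) * (e1 - p) = e1 - p.
      by rewrite mulrBl !mulrBr e11 e1p pe1 pp subrr subr0.
    have sq : sub (e1 - p) e1.
      by split=> //; rewrite ?mulrBl ?mulrBr e11 ?e1p ?pe1.
    rewrite -(subrKC p e1); apply: witt_extensionD; rewrite ?subrKC //.
    - by rewrite mulrBr pe1 pp subrr.
    - by rewrite mulrBl e1p pp subrr.
    - exact: W.
    - apply: W => // /eqP; rewrite -subr_eq0 addrAC subrr add0r oppr_eq0.
      by move/eqP.
  have triv' p : sub p e1 -> p = 0 \/ p = e1.
    move=> sp; have [?|p0] := pselect (p = 0); first by left.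
    by right; apply: contrapT => p1; apply: triv; exists p.
  apply: (@witt_extension_local e1 (e1 * h)) => //; first by rewrite mulrA e11.
    by rewrite -mulrDr hh e1e.
  move=> x e1x xe1.
  have [||n [y [xy xyx]]] := regular x.
  - by rewrite -e1x mulrA ee1.
  - by rewrite -xe1 -mulrA e1e.
  set b := x ^+ n.+1 in xy xyx.
  have e1b : e1 * b = b by rewrite /b exprS mulrA e1x.
  have be1 : b * e1 = b by rewrite /b exprSr -mulrA xe1.
  (* The idempotent b y is 0 or [e1]: in the first case [x] is nilpotent, in the second it is
     invertible in the corner. *)
  have [|b0|bye1] := triv' (b * y).
  - split; first by rewrite mulrA e1b.
      by rewrite xy -mulrA be1.
    by rewrite mulrA xyx.
  - right; apply: (@nilpotent_inverse_in _ _ n.+1) => //.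
    by rewrite -/b -xyx b0 mul0r.
  left; pose y1 := e1 * x ^+ n * y * e1; pose y2 := e1 * y * x ^+ n * e1.
  have r1 : x * y1 = e1 by rewrite /y1 !mulrA xe1 -exprS -/b bye1 e11.
  have l2 : y2 * x = e1 by rewrite -!mulrA e1x -exprSr -/b -xy bye1 e11.
  have y12 : y2 = y1.
    have y2e : y2 * e1 = y2 by rewrite /y2 -mulrA e11.
    by rewrite -y2e -r1 mulrA l2 /y1 !mulrA e11.
  by exists y1; split; rewrite ?r1 // -?y12 ?l2 // /y2 ?mulrA ?e11 // -mulrA e11.
apply: contrapT => We.
(* Iterated choice gives a strictly decreasing sequence of idempotents without the property. Its
   successive differences are nonzero orthogonal idempotents. *)
pose bad := {e1 | sub e1 e /\ ~ witt_extension e1}.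
have /choice [next nextP] (b : bad) :
    exists c : bad, sub (sval c) (sval b) /\ sval c <> sval b.
  case: b => e1 [se1 W1] /=; have [e2 [s21 e21 W2]] := step _ se1 W1.
  by exists (exist _ e2 (conj (subT _ _ _ s21 se1) W2)).
have bad_e : sub e e /\ ~ witt_extension e by split.
pose c n := sval (iter n next (exist _ e bad_e)).
have c_sub_e n : sub (c n) e by rewrite /c; case: (iter n next _) => e1 [].
have c_step n : sub (c n.+1) (c n) by case: (nextP (iter n next (exist _ e bad_e))).
have c_neq n : c n.+1 <> c n by case: (nextP (iter n next (exist _ e bad_e))).
have c_le m n : (m <= n)%N -> sub (c n) (c m).
  move=> /subnK <-; elim: (n - m)%N => [|k IH]; last exact: subT (c_step _) IH.
  by have [_ _ cc] := c_sub_e m.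
have [n|n|n|m n|n] := fin (fun n => c n - c n.+1).
- by rewrite mulrBr; case: (c_sub_e n) => -> _ _; case: (c_sub_e n.+1) => -> _ _.
- by rewrite mulrBl; case: (c_sub_e n) => _ -> _; case: (c_sub_e n.+1) => _ -> _.
- have [c1 c2 c3] := c_step n; have [_ _ c4] := c_sub_e n.
  by rewrite mulrBl !mulrBr c1 c2 c3 c4 subrr subr0.
- rewrite neq_ltn mulrBl !mulrBr => /orP[] mn.
    have [-> _ _] := c_le _ _ (ltnW mn); have [-> _ _] := c_le _ _ (leqW (ltnW mn)).
    have [-> _ _] := c_le _ _ mn; have [-> _ _] := c_le _ _ (leqW mn).
    by rewrite subrr.
  have [_ -> _] := c_le _ _ (ltnW mn); have [_ -> _] := c_le _ _ (leqW (ltnW mn)).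
  have [_ -> _] := c_le _ _ mn; have [_ -> _] := c_le _ _ (leqW mn).
  by rewrite !subrr.
- by move/eqP; rewrite subr_eq0 => /eqP /esym /c_neq.
Qed.
End Witt.

(** * Additive categories: zeros, signs and biproduct identities *)

Section AdditiveCategory.
Variable C : additive_category.
Implicit Types X Y Z : C.

Lemma comp0m X Y Z (f : Mor X Y) : (0 : Mor Y Z) \oc f = 0.
Proof. by apply: (addrI (0 \oc f)); rewrite -compDl !addr0. Qed.

Lemma compm0 X Y Z (f : Mor Y Z) : f \oc (0 : Mor X Y) = 0.
Proof. by apply: (addrI (f \oc 0)); rewrite -compDr !addr0. Qed.

Lemma compNm X Y Z (f : Mor X Y) (g : Mor Y Z) : (- g) \oc f = - (g \oc f).
Proof. by apply: (addrI (g \oc f)); rewrite -compDl !subrr comp0m. Qed.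

Lemma compmN X Y Z (f : Mor X Y) (g : Mor Y Z) : g \oc (- f) = - (g \oc f).
Proof. by apply: (addrI (g \oc f)); rewrite -compDr !subrr compm0. Qed.

(** Lets an equation for a composite be used inside a right-nested composition. *)
Lemma comp_assoc_eq X Y Z T (f : Mor T X) (g : Mor X Y) (k : Mor Y Z) l :
  k \oc g = l -> k \oc (g \oc f) = l \oc f.
Proof. by move=> <-; rewrite compA. Qed.

Definition dsumE := (pr1_in1, pr2_in2, pr1_in2, pr2_in1).

Lemma pr1_in1A X Y Z (f : Mor Z X) : pr1 X Y \oc (in1 X Y \oc f) = f.
Proof. by rewrite compA dsumE comp1m. Qed.

Lemma pr2_in2A X Y Z (f : Mor Z Y) : pr2 X Y \oc (in2 X Y \oc f) = f.
Proof. by rewrite compA dsumE comp1m. Qed.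

Lemma pr1_in2A X Y Z (f : Mor Z Y) : pr1 X Y \oc (in2 X Y \oc f) = 0.
Proof. by rewrite compA dsumE comp0m. Qed.

Lemma pr2_in1A X Y Z (f : Mor Z X) : pr2 X Y \oc (in1 X Y \oc f) = 0.
Proof. by rewrite compA dsumE comp0m. Qed.

Variable h : hermitian_structure C.

Lemma dualm0 X Y : dualm h (0 : Mor X Y) = 0.
Proof. by apply: (addrI (dualm h 0)); rewrite -dualmD !addr0. Qed.

Lemma dualmN X Y (f : Mor X Y) : dualm h (- f) = - dualm h f.
Proof. by apply: (addrI (dualm h f)); rewrite -dualmD !subrr dualm0. Qed.
End AdditiveCategory.

Definition compE := (compDl, compDr, compNm, compmN, comp0m, compm0, comp1m, compm1).

Definition dsumEA := (pr1_in1A, pr2_in2A, pr1_in2A, pr2_in1A).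

(** * Adjoint pairs and isometries of systems of forms *)

Section Adjoints.
Variables (C : additive_category) (I : Type) (h : I -> hermitian_structure C).
Implicit Types X Y Z : sesq_system h.

(* Pairs of mutually adjoint maps are the morphisms of a category with
   involution (a, b) |-> (b, a), whose unitary morphisms are the isometries. *)
Definition adjoint_pair X Y (a : Mor (carrier X) (carrier Y))
    (b : Mor (carrier Y) (carrier X)) :=
  (forall i, form Y i \oc a = dualm (h i) b \oc form X i) /\
  (forall i, form X i \oc b = dualm (h i) a \oc form Y i).

Lemma adjoint_pair_sym X Y a b : @adjoint_pair X Y a b -> adjoint_pair b a.
Proof. by case. Qed.

Lemma adjoint_pair1 X : @adjoint_pair X X (idm _) (idm _).
Proof. by split=> i; rewrite dualm1 comp1m compm1. Qed.

Lemma adjoint_pairD X Y a b a' b' : @adjoint_pair X Y a b ->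
  adjoint_pair a' b' -> adjoint_pair (a + a') (b + b').
Proof.
by move=> [ab ba] [ab' ba']; split=> i; rewrite dualmD compDl compDr ?ab ?ab' ?ba ?ba'.
Qed.

Lemma adjoint_pairN X Y a b :
  @adjoint_pair X Y a b -> adjoint_pair (- a) (- b).
Proof. by move=> [ab ba]; split=> i; rewrite dualmN compNm compmN ?ab ?ba. Qed.

Lemma adjoint_pair_comp X Y Z a b a' b' : @adjoint_pair X Y a b ->
  @adjoint_pair Y Z a' b' -> adjoint_pair (a' \oc a) (b \oc b').
Proof.
by move=> [ab ba] [ab' ba']; split=> i;
  rewrite compA ?ab' ?ba -compA ?ab ?ba' compA dualm_comp.
Qed.

(** Since injections and projections are adjoint, block maps between orthogonal sums obtain their
    adjoints by sums and composites alone. *)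
Lemma adjoint_pair_in1 X Y : adjoint_pair (X := X) (Y := orth_sum X Y)
  (in1 _ _) (pr1 _ _).
Proof.
split=> i; rewrite /= !compE; first by rewrite -!compA !dsumE !compE addr0.
by rewrite !compA -!dualm_comp !dsumE dualm1 dualm0 !compE addr0.
Qed.

Lemma adjoint_pair_in2 X Y : adjoint_pair (X := Y) (Y := orth_sum X Y)
  (in2 _ _) (pr2 _ _).
Proof.
split=> i; rewrite /= !compE; first by rewrite -!compA !dsumE !compE add0r.
by rewrite !compA -!dualm_comp !dsumE dualm1 dualm0 !compE add0r.
Qed.

Lemma adjoint_pair_pr1 X Y : adjoint_pair (X := orth_sum X Y) (Y := X)
  (pr1 _ _) (in1 _ _).
Proof. exact/adjoint_pair_sym/adjoint_pair_in1. Qed.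

Lemma adjoint_pair_pr2 X Y : adjoint_pair (X := orth_sum X Y) (Y := Y)
  (pr2 _ _) (in2 _ _).
Proof. exact/adjoint_pair_sym/adjoint_pair_in2. Qed.

(** Composing the isometry equation with the inverse of [a], or with the dual of that inverse, shows
    that the inverse is an adjoint of [a]. *)
Lemma isometricP X Y : isometric X Y <->
  exists a b, [/\ adjoint_pair (X := X) (Y := Y) a b, b \oc a = idm _ & a \oc b
      = idm _].
Proof.
split=> [[a [[b [ba ab]] aX]]|[a [b [[aY bX] ba ab]]]].
  exists a, b; split=> //; split=> i.
    by rewrite -aX !compA -dualm_comp ab dualm1 comp1m.
  by rewrite -aX -!compA ab compm1.
exists a; split; first by exists b.
by move=> i; rewrite -bX -compA ba compm1.
Qed.

Lemma isometric_sym X Y : isometric X Y -> isometric Y X.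
Proof.
move/isometricP=> [a [b [/adjoint_pair_sym ab e1 e2]]].
by apply/isometricP; exists b, a.
Qed.

Lemma isometric_trans X Y Z : isometric X Y -> isometric Y Z -> isometric X Z.
Proof.
move=> /isometricP[a [b [ab e1 e2]]] /isometricP[a' [b' [ab' e1' e2']]].
apply/isometricP; exists (a' \oc a), (b \oc b'); split.
- exact: adjoint_pair_comp ab ab'.
- by rewrite -compA (comp_assoc_eq _ e1') comp1m.
- by rewrite -compA (comp_assoc_eq _ e2) comp1m.
Qed.

Lemma isometric_sumr X Y Z :
  isometric Y Z -> isometric (orth_sum X Y) (orth_sum X Z).
Proof.
move=> /isometricP[a [b [ab e1 e2]]]; apply/isometricP.
exists (in1 _ _ \oc pr1 _ _ + in2 _ _ \oc (a \oc pr2 _ _)).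
exists (in1 _ _ \oc pr1 _ _ + in2 _ _ \oc b \oc pr2 _ _); split.
- apply: adjoint_pairD.
    exact: adjoint_pair_comp (adjoint_pair_pr1 _ _) (adjoint_pair_in1 _ _).
  exact: adjoint_pair_comp (adjoint_pair_comp (adjoint_pair_pr2 _ _) ab)
    (adjoint_pair_in2 _ _).
- rewrite /= !compE -!compA !dsumEA !compE addr0 add0r (comp_assoc_eq _ e1) comp1m.
  exact: dsum_id.
- rewrite /= !compE -!compA !dsumEA !compE addr0 add0r (comp_assoc_eq _ e2) comp1m.
  exact: dsum_id.
Qed.

Lemma isometric_sumA X Y Z :
  isometric (orth_sum X (orth_sum Y Z)) (orth_sum (orth_sum X Y) Z).
Proof.
apply/isometricP.
exists (in1 _ _ \oc (in1 _ _ \oc pr1 _ _) +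
  (in1 _ _ \oc (in2 _ _ \oc (pr1 _ _ \oc pr2 _ _)) +
  in2 _ _ \oc (pr2 _ _ \oc pr2 _ _))).
exists (in1 _ _ \oc pr1 _ _ \oc pr1 _ _ +
  (in2 _ _ \oc in1 _ _ \oc pr2 _ _ \oc pr1 _ _ + in2 _ _ \oc in2 _ _ \oc pr2 _ _)).
split.
-   do !apply: adjoint_pairD.
  + exact: adjoint_pair_comp (adjoint_pair_comp (adjoint_pair_pr1 _ _)
      (adjoint_pair_in1 _ _)) (adjoint_pair_in1 _ _).
  + exact: adjoint_pair_comp (adjoint_pair_comp (adjoint_pair_comp
      (adjoint_pair_pr2 _ _) (adjoint_pair_pr1 _ _)) (adjoint_pair_in2 _ _))
          (adjoint_pair_in1 _ _).
  + exact: adjoint_pair_comp (adjoint_pair_comp (adjoint_pair_pr2 _ _)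
      (adjoint_pair_pr2 _ _)) (adjoint_pair_in2 _ _).
- rewrite /= !compE -!compA !dsumEA !compE !addr0 !add0r.
  rewrite -[RHS]dsum_id -[in2 _ (dsum _ _) in RHS]compm1 -(dsum_id (carrier Y)).
  by rewrite compDr compDl -!compA.
- rewrite /= !compE -!compA !dsumEA !compE !addr0 !add0r.
  rewrite -[RHS]dsum_id -[in1 (dsum _ _) _ in RHS]compm1 -(dsum_id (carrier X)).
  by rewrite compDr compDl -!compA addrA.
Qed.
End Adjoints.

(** * Corners of endomorphism rings and group inverses *)

Lemma End_mulE (C : additive_category) (M : C) (x y : End M) : x * y = x \oc y.
Proof. by []. Qed.

(** Serves to bring two group-invertible powers to a common exponent. *)
Lemma group_inverseX (R : pzRingType) (b g : R) n :
  group_inverse b g -> group_inverse (b ^+ n) (g ^+ n).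
Proof.
move=> [bg bgb gbg].
have bgC m k : b ^+ m * g ^+ k = g ^+ k * b ^+ m
    by apply/commrX/commr_sym/commrX/commr_sym.
have bgX : b ^+ n * g ^+ n = (b * g) ^+ n by rewrite exprMn_comm.
split; first exact: bgC.
- rewrite bgX -exprMn_comm ?bgb //.
  by apply/commr_sym/commrM => //; apply: commr_refl.
- rewrite -bgC bgX -exprMn_comm ?[b * g]bg ?gbg //.
  by apply/commr_sym/commrM => //; apply: commr_refl.
Qed.

Section Corner.
Variables (C : additive_category) (M N : C) (i : Mor M N) (p : Mor N M).
Hypothesis spM : semiprimary (End M).
Hypothesis pi1 : p \oc i = idm M.
Implicit Types x : End N.

(** The map sending x to p x i identifies the corner at i p with [End M], so a group inverse found
    there can be carried back. *)
Lemma corner_group_inverse x : i \oc p \oc x = x -> x \oc (i \oc p) = x ->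
  exists n g, group_inverse (x ^+ n.+1) g.
Proof.
move=> ex xe; have [n [g [bg bgb gbg]]] :=
  semiprimary_group_inverse spM (p \oc x \oc i).
(* Only positive powers correspond: the zeroth power of [x] is the identity of [N], outside the
   corner in general. *)
have xE m : x ^+ m.+1 = i \oc (p \oc x \oc i : End M) ^+ m.+1 \oc p.
  elim: m => [|m IH]; first by rewrite !expr1 -!compA xe compA ex.
  rewrite exprS IH [in RHS]exprS; move: (_ ^+ m.+1) => z.
  by rewrite !End_mulE -{1}ex !compA.
exists n, (i \oc g \oc p); rewrite xE.
move: (_ ^+ _) bg bgb gbg => b bg bgb gbg.
have ippM (u v : End M) : (i \oc u \oc p : End N) * (i \oc v \oc p) =
    i \oc (u * v) \oc p.
  by rewrite !End_mulE -!compA (comp_assoc_eq _ pi1) comp1m.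
by rewrite /group_inverse !ippM bgb gbg bg.
Qed.

Lemma corner_orth_idem (d : nat -> End N) :
    (forall n, i \oc p \oc d n = d n) -> (forall n, d n \oc (i \oc p) = d n) ->
    (forall n, d n * d n = d n) -> (forall m n, m != n -> d m * d n = 0) ->
  exists m, forall n, (m <= n)%N -> d n = 0.
Proof.
move=> ed de dd d0.
have pxiM (x y : End N) : x \oc (i \oc p) = x ->
    (p \oc x \oc i : End M) * (p \oc y \oc i) = p \oc (x * y) \oc i.
  by move=> xe; rewrite !End_mulE -[in RHS]xe !compA.
have [n|m n mn|m dm] := @semiprimary_orth_idem _ spM (fun n => p \oc d n \oc i).
- by rewrite pxiM ?dd.
- by rewrite pxiM // d0 ?(ltn_eqF mn) // compm0 comp0m.
exists m => n /dm dn; have -> : d n = i \oc (p \oc d n \oc i) \oc p.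
  by rewrite -{1}(ed n) -{1}(de n) !compA.
by rewrite dn compm0 comp0m.
Qed.
End Corner.


(** Duality reverses composition, and the defining equations are symmetric under reversal. *)
Lemma group_inverse_dual (C : additive_category) (h : hermitian_structure C)
    (M : C) (b g : End M) :
  group_inverse b g -> group_inverse (dualm h b : End (dual h M)) (dualm h g).
Proof.
move=> []; rewrite /group_inverse !End_mulE -!dualm_comp => bg bgb gbg.
by rewrite !compA bgb gbg bg.
Qed.

(* The group inverse lies in the double commutant, here for a pair (b, b'). *)
Lemma group_inverse_intertwine (C : additive_category) (M N : C)
    (b g : End M) (b' g' : End N) (s : Mor M N) :
    group_inverse b g -> group_inverse b' g' ->
  s \oc b = b' \oc s -> s \oc g = g' \oc s.
Proof.
move=> []; rewrite !End_mulE => bg bgb gbg [].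
rewrite !End_mulE => bg' bgb' gbg' sb.
have gbb : g' \oc b' \oc b' = b' by rewrite -bg'.
have bbg : b \oc b \oc g = b by rewrite -compA bg compA.
(* First [s] intertwines the idempotents b g and g' b'; the inverses follow. *)
have gbs : g' \oc b' \oc s = s \oc b \oc g.
  transitivity (g' \oc b' \oc s \oc b \oc g).
    by rewrite -(compA g') -sb -!compA (compA b) bbg.
  by rewrite -(compA _ s) sb compA gbb -sb.
rewrite -{1}gbg -bg !compA -gbs -(compA g') -sb -(compA g') -gbs !compA.
by rewrite -(compA g' g') -bg' compA gbg'.
Qed.

(** * The ring with involution formed by adjoint pairs *)

Section AdjointRing.
Variables (C : additive_category) (I : Type) (h : I -> hermitian_structure C).
Variable X : sesq_system h.
(** The forms may be degenerate, so an endomorphism can have several adjoints or none; a chosen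
    adjoint is part of the data. It lives in the opposite ring because taking adjoints reverses
    composition. *)
Local Notation R := (End (carrier X) * (End (carrier X))^c)%type.

Definition adjoint_pred : {pred R} :=
  fun x => `[< adjoint_pair (X := X) (Y := X) x.1 x.2 >].

Lemma adjoint_subring_closed : subring_closed adjoint_pred.
Proof.
split=> [|x y /asboolP xP /asboolP yP|x y /asboolP xP /asboolP yP]; apply/asboolP.
- exact: adjoint_pair1.
- exact: adjoint_pairD xP (adjoint_pairN yP).
- exact: adjoint_pair_comp yP xP.
Qed.

Record adjoint_ring := AdjointRing {
  adjoint_val : R;
  adjoint_valP : adjoint_val \in adjoint_pred }.

HB.instance Definition _ := [isSub for adjoint_val].
HB.instance Definition _ := [Choice of adjoint_ring by <:].
HB.instance Definition _ :=
  GRing.SubChoice_isSubPzRing.Build R adjoint_pred adjoint_ring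
    adjoint_subring_closed.

Implicit Types x y : adjoint_ring.
Definition mkadj (a b : End (carrier X))
    (ab : adjoint_pair (X := X) (Y := X) a b) : adjoint_ring :=
  @AdjointRing (a, b) (asboolT ab).

Definition adj1 x : End (carrier X) := (\val x).1.
Definition adj2 x : End (carrier X) := (\val x).2.

Lemma adjP x : adjoint_pair (adj1 x) (adj2 x).
Proof. by have /asboolP := valP x. Qed.

Lemma adj_inj x y : adj1 x = adj1 y -> adj2 x = adj2 y -> x = y.
Proof.
case: x => [[x1 x2] xP]; case: y => [[y1 y2] yP] /= e1 e2.
by apply/val_inj; rewrite /=; congr (_, _).
Qed.

Lemma adj1D x y : adj1 (x + y) = adj1 x + adj1 y. Proof. by []. Qed.
Lemma adj2D x y : adj2 (x + y) = adj2 x + adj2 y. Proof. by []. Qed.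
Lemma adj1M x y : adj1 (x * y) = adj1 x \oc adj1 y. Proof. by []. Qed.
Lemma adj2M x y : adj2 (x * y) = adj2 y \oc adj2 x. Proof. by []. Qed.

Lemma adj1_mkadj a b ab : adj1 (@mkadj a b ab) = a. Proof. by []. Qed.
Lemma adj2_mkadj a b ab : adj2 (@mkadj a b ab) = b. Proof. by []. Qed.
Definition adjE := (adj1D, adj2D, adj1M, adj2M, adj1_mkadj, adj2_mkadj).

Lemma adj1X x n : adj1 (x ^+ n) = adj1 x ^+ n.
Proof. by elim: n => // n IH; rewrite !exprS adj1M IH. Qed.

Lemma adj2X x n : adj2 (x ^+ n) = adj2 x ^+ n.
Proof. by elim: n => // n IH; rewrite exprS exprSr adj2M IH. Qed.

Definition dag x := mkadj (adjoint_pair_sym (adjP x)).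

Lemma dagD x y : dag (x + y) = dag x + dag y.
Proof. exact: adj_inj. Qed.

Lemma dagM x y : dag (x * y) = dag y * dag x.
Proof. exact: adj_inj. Qed.

Lemma dagK x : dag (dag x) = x.
Proof. exact: adj_inj. Qed.
End AdjointRing.

Section AdjointRingRegular.
Variables (C : additive_category) (I : Type) (h : I -> hermitian_structure C).
Variable X : sesq_system h.

(** Each form intertwines [a] with the dual of [b], hence also their group inverses; the other
    equation is symmetric. *)
Lemma adjoint_pair_group_inverse (a b g k : End (carrier X)) :
    adjoint_pair (X := X) (Y := X) a b -> group_inverse a g -> group_inverse b k ->
  adjoint_pair (X := X) (Y := X) g k.
Proof.
move=> [ab ba] ag bk; split=> i.
  exact: group_inverse_intertwine ag (group_inverse_dual _ bk) (ab i).
exact: group_inverse_intertwine bk (group_inverse_dual _ ag) (ba i).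
Qed.

(** The product of the two exponents serves both components, and the componentwise group inverses
    form an adjoint pair. *)
Lemma adjoint_ring_group_inverse (x : adjoint_ring X) :
    (exists n g, group_inverse (adj1 x ^+ n.+1) g) ->
    (exists n g, group_inverse (adj2 x ^+ n.+1) g) ->
  exists n y, group_inverse (x ^+ n.+1) y.
Proof.
move=> [m [g xg]] [n [k xk]]; set N := (m.+1 * n.+1)%N.
have {}xg : group_inverse (adj1 (x ^+ N)) (g ^+ n.+1).
  by rewrite adj1X exprM; apply: group_inverseX.
have {}xk : group_inverse (adj2 (x ^+ N)) (k ^+ m.+1).
  by rewrite adj2X /N mulnC exprM; apply: group_inverseX.
have gk := adjoint_pair_group_inverse (adjP (x ^+ N)) xg xk.
exists N.-1, (mkadj gk); rewrite prednK //.
have [g1 g2 g3] := xg; have [k1 k2 k3] := xk.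
by split; apply: adj_inj; rewrite ?adjE -?End_mulE // mulrA.
Qed.
End AdjointRingRegular.

(** * Cancellation of a hyperbolic summand *)

Section Cancellation.
Variables (C : additive_category) (I : Type) (h : I -> hermitian_structure C).
Implicit Types H S X Y Z : sesq_system h.

(** Both [a] and [b] are block triangular with identity on [H], so their lower diagonal blocks are
    mutually inverse and remain adjoint. *)
Lemma isometric_complement H Y Z a b :
    @adjoint_pair C I h (orth_sum H Y) (orth_sum H Z) a b ->
    b \oc a = idm _ -> a \oc b = idm _ ->
    pr1 _ _ \oc a = pr1 _ _ -> pr1 _ _ \oc b = pr1 _ _ ->
  isometric Y Z.
Proof.
have compl A B (x : Mor (dsum (carrier H) A) (dsum (carrier H) B))
    (y : Mor (dsum (carrier H) B) (dsum (carrier H) A)) :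
    y \oc x = idm _ -> pr1 _ _ \oc x = pr1 _ _ ->
    pr2 _ _ \oc y \oc in2 _ _ \oc (pr2 _ _ \oc x \oc in2 _ _) = idm A.
  move=> yx px; rewrite -!compA (compA (in2 _ B)).
  have -> : in2 (carrier H) B \oc pr2 _ _ = idm _ - in1 _ _ \oc pr1 _ _.
    by rewrite -dsum_id addrC addKr.
  rewrite !compE -!compA (comp_assoc_eq _ px) dsumE !compE oppr0 addr0.
  by rewrite (comp_assoc_eq _ yx) comp1m dsumE.
move=> ab ba ab1 pa pb; apply/isometricP.
exists (pr2 _ _ \oc a \oc in2 _ _), (pr2 _ _ \oc b \oc in2 _ _); split.
- rewrite -(compA _ a).
  exact: adjoint_pair_comp (adjoint_pair_comp (adjoint_pair_in2 _ _) ab)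
      (adjoint_pair_pr2 _ _).
- exact: compl.
- exact: compl.
Qed.

(* The idempotent d s of End H and its adjoint d' s' exhibit H as hyperbolic;
   M is the first lagrangian. *)
Lemma hyperbolic_cancel M H Y Z (d : Mor M (carrier H)) (s : Mor (carrier H) M)
    (d' : Mor M (carrier H)) (s' : Mor (carrier H) M) (eta : End (carrier H)) :
    semiprimary (End M) ->
    s \oc d = idm M -> s' \oc d' = idm M -> s \oc d' = 0 -> s' \oc d = 0 ->
    d \oc s + d' \oc s' = idm _ ->
    adjoint_pair (X := H) (Y := H) (d \oc s) (d' \oc s') ->
    eta + eta = idm _ -> adjoint_pair (X := H) (Y := H) eta eta ->
  isometric (orth_sum H Y) (orth_sum H Z) -> isometric Y Z.
Proof.
move=> spM sd sd' sd0 sd0' ds1 ds eta2 etaP.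
move=> /isometricP[a [b [ab ba1 ab1]]].
pose X := orth_sum H Z.
have cornerP x y : adjoint_pair (X := H) (Y := H) x y ->
    adjoint_pair (X := X) (Y := X) (in1 _ _ \oc x \oc pr1 _ _)
        (in1 _ _ \oc y \oc pr1 _ _).
  move=> xy; rewrite -[X in adjoint_pair X]compA.
  exact: adjoint_pair_comp (adjoint_pair_comp (adjoint_pair_pr1 _ _) xy)
      (adjoint_pair_in1 _ _).
pose e : adjoint_ring X := mkadj (cornerP _ _ ds).
pose hf : adjoint_ring X := mkadj (cornerP _ _ (adjoint_pair_comp etaP ds)).
pose k : adjoint_ring X := mkadj
  (adjoint_pair_comp (adjoint_pair_pr2 H Z) (adjoint_pair_in2 H Z)).
(* The restriction of [a] to [H], extended by zero on [Z]: as the source is only [H], it becomes an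
   endomorphism of H + Z. *)
have vP : adjoint_pair (X := X) (Y := X) (a \oc (in1 _ _ \oc pr1 _ _))
    (in1 _ _ \oc pr1 _ _ \oc b).
  apply: adjoint_pair_comp ab.
  exact: adjoint_pair_comp (adjoint_pair_pr1 _ _) (adjoint_pair_in1 _ _).
pose v : adjoint_ring X := mkadj vP.
have e1 : adj1 e = in1 _ _ \oc (d \oc s) \oc pr1 _ _ by [].
have e2 : adj2 e = in1 _ _ \oc (d' \oc s') \oc pr1 _ _ by [].
have v1 : adj1 v = a \oc (in1 _ _ \oc pr1 _ _) by [].
have v2 : adj2 v = in1 _ _ \oc pr1 _ _ \oc b by [].
have hypE : hyp (@dag _ _ _ X) e = mkadj
  (adjoint_pair_comp (adjoint_pair_pr1 H Z) (adjoint_pair_in1 H Z)).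
  apply: adj_inj; rewrite ?adjE -compDl -compDr ?[d' \oc _ + _]addrC ds1 compm1 //.
have hk1 : hyp (@dag _ _ _ X) e + k = 1.
  by rewrite hypE; apply: adj_inj; exact: dsum_id.
have blockM (x y : End (carrier H)) : in1 _ (carrier Z) \oc x \oc pr1 _ _ \oc
    (in1 _ (carrier Z) \oc y \oc pr1 _ _) = in1 _ _ \oc (x \oc y) \oc pr1 _ _.
  by rewrite -!compA pr1_in1A.
have idem : d \oc s \oc (d \oc s) = d \oc s
    by rewrite -compA (comp_assoc_eq _ sd) comp1m.
have idem' : d' \oc s' \oc (d' \oc s') = d' \oc s'
    by rewrite -compA (comp_assoc_eq _ sd') comp1m.
have orth : d \oc s \oc (d' \oc s') = 0
    by rewrite -compA (comp_assoc_eq _ sd0) comp0m compm0.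
have orth' : d' \oc s' \oc (d \oc s) = 0
    by rewrite -compA (comp_assoc_eq _ sd0') comp0m compm0.
have eI : isotropic_idem (@dag _ _ _ X) e.
  by split; apply: adj_inj; rewrite ?adjE ?e1 ?e2 blockM ?(idem, idem', orth, orth')
    // compm0 comp0m.
have half : hf + hf = e.
  apply: adj_inj; rewrite ?adjE -compDl -compDr.
    by rewrite -compDr eta2 compm1.
  by rewrite -compDl eta2 comp1m.
have kO : orth_complement (@dag _ _ _ X) e k.
  by split; apply: adj_inj => //; rewrite ?adjE ?e1 ?e2 ?v1 ?v2 -!compA ?dsumEA
      ?compm0 //.
have vI : partial_isometry (@dag _ _ _ X) (hyp (@dag _ _ _ X) e)
    (hyp (@dag _ _ _ X) e + k) v.
  split; last by rewrite hk1 mul1r.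
    rewrite hypE; apply: adj_inj; rewrite ?adjE ?v1 ?v2;
      by rewrite -!compA (comp_assoc_eq _ ba1) comp1m pr1_in1A.
  by rewrite hypE; apply: adj_inj; rewrite ?adjE ?e1 ?e2 ?v1 ?v2 -!compA ?dsumEA.
have [u [_ _ u1 u2] uv] : extends_to_unitary (@dag _ _ _ X) (hyp (@dag _ _ _ X) e)
    (hyp (@dag _ _ _ X) e + k) v.
  (* Each component of [e] splits through [M], so each corner is isomorphic to the semiprimary ring
     [End M]. *)
  have si : s \oc pr1 _ (carrier Z) \oc (in1 _ _ \oc d) = idm M.
    by rewrite -compA pr1_in1A.
  have si' : s' \oc pr1 _ (carrier Z) \oc (in1 _ _ \oc d') = idm M.
    by rewrite -compA pr1_in1A.
  have e1E : adj1 e = in1 _ _ \oc d \oc (s \oc pr1 _ _) by rewrite e1 !compA.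
  have e2E : adj2 e = in1 _ _ \oc d' \oc (s' \oc pr1 _ _) by rewrite e2 !compA.
  apply: (witt_extension_pi_regular _ _ _ eI half _ _ kO vI).
  - exact: dagD.
  - exact: dagM.
  - exact: dagK.
  - move=> x ex xe.
    have [||n [y [xy xyx _]]] := @adjoint_ring_group_inverse _ _ _ _ x;
      last by exists n, y.
      apply: (corner_group_inverse spM si); rewrite -e1E.
        by rewrite -[in RHS]ex.
      by rewrite -[in RHS]xe.
    apply: (corner_group_inverse spM si'); rewrite -e2E.
      by rewrite -[in RHS]xe.
    by rewrite -[in RHS]ex.
  - move=> x ex xe xx x0.
    have [n|n|n|m n mn|m1 m1P] := corner_orth_idem (d := fun n => adj1 (x n))
      (i := in1 _ _ \oc d) (p := s \oc pr1 _ _) spM.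
    + by rewrite -e1E -[in RHS]ex.
    + by rewrite -e1E -[in RHS]xe.
    + by rewrite -[in RHS]xx.
    + by have := congr1 (@adj1 _ _ _ X) (x0 _ _ mn); rewrite adj1M.
    have [n|n|n|m n mn|m2 m2P] := corner_orth_idem (d := fun n => adj2 (x n))
      (i := in1 _ _ \oc d') (p := s' \oc pr1 _ _) spM.
    + by rewrite -e2E -[in RHS]xe.
    + by rewrite -e2E -[in RHS]ex.
    + by rewrite -[in RHS]xx.
    + by rewrite eq_sym in mn; have := congr1 (@adj2 _ _ _ X) (x0 _ _ mn);
        rewrite adj2M.
    exists (maxn m1 m2); apply: adj_inj; first exact/m1P/leq_maxl.
    exact/m2P/leq_maxr.
rewrite hk1 in u1 u2.
have u21 : adj2 u \oc adj1 u = idm _ := congr1 (@adj1 _ _ _ X) u1.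
have u12 : adj1 u \oc adj2 u = idm _ := congr1 (@adj1 _ _ _ X) u2.
move: uv; rewrite hypE => uv.
have uva : adj1 u \oc in1 _ _ = a \oc in1 _ _.
  have := congr1 (fun x : adjoint_ring X => adj1 x \oc in1 (carrier H) (carrier Z)) uv.
  by rewrite ?adjE ?v1 ?v2 -!compA dsumE !compm1.
have uvb : pr1 _ _ \oc adj2 u = pr1 _ _ \oc b.
  have := congr1 (fun x : adjoint_ring X => pr1 (carrier H) (carrier Z) \oc adj2 x) uv.
  by rewrite ?adjE ?v1 ?v2 !compA dsumE !comp1m.
have uP := adjP u.
(* The inverse of [u] composed with [a] is an isometry from H + Y to H + Z that, like its inverse,
   preserves the projection to [H]. *)
apply: (isometric_complement (a := adj2 u \oc a) (b := b \oc adj1 u)).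
- exact: adjoint_pair_comp ab (adjoint_pair_sym uP).
- by rewrite -compA (comp_assoc_eq _ u12) comp1m.
- by rewrite -compA (comp_assoc_eq _ ab1) comp1m.
- by rewrite compA uvb -compA ba1 compm1.
- by rewrite compA -uvb -compA u21 compm1.
Qed.
End Cancellation.

(** * The sum of a system and its opposite *)

Section MetabolicSum.
Variables (C : additive_category) (I : Type) (h : I -> hermitian_structure C).
Implicit Types X : sesq_system h.

Definition opp_system X : sesq_system h := SesqSystem (fun i => - form X i).

(** Halving before or after a form gives the same map, as inserting 1 = eta + eta shows. *)
Lemma adjoint_pair_half X (eta : End (carrier X)) :
  eta + eta = idm _ -> adjoint_pair (X := X) (Y := X) eta eta.
Proof.
move=> eta2; suff H i : form X i \oc eta = dualm (h i) eta \oc form X i by split.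
transitivity (dualm (h i) eta \oc form X i \oc (eta + eta));
  last by rewrite eta2 compm1.
by rewrite compDr -compDl -compDl -dualmD eta2 dualm1 comp1m.
Qed.

(** The identity is an anti-isometry onto the opposite system, whence the sign. *)
Lemma opp_adjoint_pair X :
  (adjoint_pair (X := X) (Y := opp_system X) (idm _) (- idm _)).
Proof. by split=> i; rewrite /= ?dualmN ?dualm1 !compE. Qed.

(** The diagonal and the antidiagonal of M + M are lagrangians for -X + X, and they are
    complementary because 2 is invertible. *)
Lemma opp_system_cancel X Y Z (eta : End (carrier X)) : semiprimary (End (carrier X)) ->
    eta + eta = idm _ ->
    isometric (orth_sum (orth_sum (opp_system X) X) Y)
      (orth_sum (orth_sum (opp_system X) X) Z) ->
  isometric Y Z.
Proof.
move=> spX eta2; pose M := carrier X; pose H := orth_sum (opp_system X) X.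
have etaP := adjoint_pair_half eta2.
have etaP' : adjoint_pair (X := opp_system X) (Y := opp_system X) eta eta
    by exact: adjoint_pair_half.
have eta1 A (x : Mor A M) : eta \oc x + eta \oc x = x by rewrite -compDl eta2 comp1m.
pose i1 := in1 M M; pose i2 := in2 M M; pose p1 := pr1 M M; pose p2 := pr2 M M.
apply: (@hyperbolic_cancel _ _ h M H Y Z (i1 + i2) (eta \oc (p1 + p2))
  (i1 - i2) (eta \oc (p1 - p2)) (i1 \oc eta \oc p1 + i2 \oc eta \oc p2)) => //.
- by rewrite -compA !compE !dsumE !compE add0r addr0.
- by rewrite -compA !compE !dsumE !compE !(oppr0, opprK, add0r, addr0).
- by rewrite -compA !compE !dsumE !compE !(oppr0, add0r, addr0) subrr.
- by rewrite -compA !compE !dsumE !compE !(oppr0, opprK, add0r, addr0) subrr.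
- rewrite -(dsum_id M) !compE opprK addrACA.
  rewrite (addrACA (i1 \oc _)) subrr addr0 (addrACA (i2 \oc _)) subrr add0r.
  by congr (_ + _); rewrite -compDr eta1.
(* The first injection carries the opposite form, so its adjoint is [- p1]. Thus i1 + i2 has adjoint
   -(p1 - p2) and i1 - i2 has adjoint -(p1 + p2); the two signs cancel in the composite. *)
- have i1P : adjoint_pair (X := X) (Y := H) i1 (- p1).
    rewrite -[i1]compm1 -[p1]comp1m -compNm.
    exact: adjoint_pair_comp (opp_adjoint_pair X) (adjoint_pair_in1 _ _).
  have i2P : adjoint_pair (X := X) (Y := H) i2 p2 := adjoint_pair_in2 _ _.
  have dP := adjoint_pairD i1P i2P.
  have sP := adjoint_pairN (adjoint_pair_sym (adjoint_pairD i1P (adjoint_pairN i2P))).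
  have := adjoint_pair_comp (adjoint_pair_comp sP etaP) dP.
  have -> : - p1 + p2 = - (p1 - p2) by rewrite opprB addrC.
  by rewrite -opprD opprK !(compmN, compNm) opprK -compA.
- rewrite addrACA -[RHS]dsum_id.
  by congr (_ + _); rewrite -compDl -compDr eta2 compm1.
- apply: adjoint_pairD.
    rewrite -[Z in adjoint_pair Z _]compA.
    exact: adjoint_pair_comp (adjoint_pair_comp (adjoint_pair_pr1 _ _) etaP')
        (adjoint_pair_in1 _ _).
  rewrite -[Z in adjoint_pair Z _]compA.
  exact: adjoint_pair_comp (adjoint_pair_comp (adjoint_pair_pr2 _ _) etaP)
      (adjoint_pair_in2 _ _).
Qed.
End MetabolicSum.

(** * Witt cancellation for systems of sesquilinear forms *)

Theorem theorem5p4 (C : additive_category) (I : Type) (inhI : inhabited I)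
    (h : I -> hermitian_structure C) (S S' S'' : sesq_system h)
    (spS : semiprimary (End (carrier S)))
    (spS' : semiprimary (End (carrier S')))
    (spS'' : semiprimary (End (carrier S'')))
    (inv2S : invertible (2%:R : End (carrier S)))
    (inv2S' : invertible (2%:R : End (carrier S')))
    (inv2S'' : invertible (2%:R : End (carrier S''))) :
  isometric (orth_sum S S') (orth_sum S S'') <-> isometric S' S''.
Proof.
split; last exact: isometric_sumr.
have [eta [_ eta2]] := inv2S; rewrite mulr_natr mulr2n in eta2.
(* Add the opposite of [S] on the left of both sides and reassociate. *)
move=> SS; apply: (opp_system_cancel spS eta2).
apply: isometric_trans (isometric_trans _ (isometric_sumA _ _ _)).
  exact/isometric_sym/isometric_sumA.
exact: isometric_sumr SS.
Qed.
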